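(* Let $f$ be an even continuous non-negative function on $\mathbb{R}^n$ and let $\mu$ be the measure on $\mathbb{R}^n$ with density $f$. Let $1\le k<n$ be an integer, and suppose that $K$ is a generalized $k$-intersection body in $\mathbb{R}^n$. Then $$\mu(K)\le \frac{n}{n-k}\,c_{n,k}\,\max_{H\in G(n,n-k)}\mu(K\cap H)\;\mathrm{Vol}_n(K)^{k/n},$$ where $c_{n,k}=|B_2^n|^{(n-k)/n}/|B_2^{n-k}|$.
   Context: $|B_2^m|$ denotes the volume of the Euclidean unit ball in $\mathbb{R}^m$, and $\mathrm{Vol}_n$ is $n$-dimensional Lebesgue measure. $S^{n-1}$ is the Euclidean unit sphere in $\mathbb{R}^n$. $G(n,n-k)$ is the Grassmannian of $(n-k)$-dimensional linear subspaces of $\mathbb{R}^n$. For a closed bounded set $B\subset\mathbb{R}^n$, $\mu(B)=\int_B f(x)\,dx$; for an $(n-k)$-dimensional subspace $H$, $\mu(B\cap H)=\int_{B\cap H}f(x)\,dx$, where the integral is with respect to $(n-k)$-dimensional Lebesgue measure on $H$. A closed bounded set $K\subset\mathbb{R}^n$ is a star body if every straight line through the origin crosses the boundary of $K$ at exactly two points different from the origin, the origin is an interior point of $K$, and the Minkowski functional $\|x\|_K=\min\{a\ge 0: x\in aK\}$ is a continuous function on $\mathbb{R}^n$. It is origin-symmetric if $K=-K$. The $(n-k)$-dimensional spherical Radon transform $\mathcal{R}_{n-k}:C(S^{n-1})\to C(G(n,n-k))$ is defined by $\mathcal{R}_{n-k}(g)(H)=\int_{S^{n-1}\cap H} g(x)\,dx$,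 where integration is with respect to the (unnormalized) surface measure on the unit sphere $S^{n-1}\cap H$ of $H$ (counting measure if $n-k=1$). Let $X=\mathcal{R}_{n-k}(C(S^{n-1}))\subset C(G(n,n-k))$, and let $M^+(X)$ be the set of linear continuous (in the sup norm) functionals $\nu$ on $X$ that are positive, i.e. $\nu(h)\ge 0$ for every non-negative $h\in X$. An origin-symmetric star body $K$ in $\mathbb{R}^n$ is called a generalized $k$-intersection body if there exists $\nu\in M^+(X)$ such that for every $g\in C(S^{n-1})$, $$\int_{S^{n-1}}\|x\|_K^{-k}g(x)\,dx=\nu(\mathcal{R}_{n-k}(g)),$$ where $dx$ is the unnormalized surface measure on $S^{n-1}$. *)

(* Defs.v *)
From HB Require Import structures.
From mathcomp Require Import all_boot all_order all_algebra.
From mathcomp Require Import all_classical all_reals all_analysis.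
From mathcomp Require Import measurable_realfun.

Set Implicit Arguments.
Unset Strict Implicit.
Unset Printing Implicit Defensive.

Import Order.TTheory GRing.Theory Num.Theory.
Import numFieldNormedType.Exports.

Local Open Scope classical_set_scope.
Local Open Scope ring_scope.

(* The Borel sigma-algebra of R^n, as the product sigma-algebra: the smallest
   one for which all coordinate projections are measurable. *)
Definition rV_display : measure_display.
Proof. exact: default_measure_display. Qed.

Section measurable_rV.
Context {R : realType} (n : nat).

Definition coord_rV (i : 'I_n) (x : 'rV[R]_n) : measurableTypeR R := x 0 i.

Let rV_set0 : g_sigma_preimage coord_rV set0.
Proof. exact: sigma_algebra0. Qed.

Let rV_setC A : g_sigma_preimage coord_rV A -> g_sigma_preimage coord_rV (~` A).
Proof. exact: sigma_algebraC. Qed.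

Let rV_bigcup (F : _^nat) : (forall i, g_sigma_preimage coord_rV (F i)) ->
  g_sigma_preimage coord_rV (\bigcup_i (F i)).
Proof. exact: sigma_algebra_bigcup. Qed.

HB.instance Definition _ := @isMeasurable.Build rV_display
  'rV[R]_n (g_sigma_preimage coord_rV) rV_set0 rV_setC rV_bigcup.

End measurable_rV.

Section measurability.
Context {R : realType}.

Lemma measurable_coord n (i : 'I_n) :
  measurable_fun [set: 'rV[R]_n] (coord_rV i).
Proof.
move=> _ Y mY; rewrite setTI; apply: sub_sigma_algebra => /=.
rewrite -bigcup_seq/=; exists i => /=; first by rewrite mem_index_enum.
by exists Y => //; rewrite setTI.
Qed.

Lemma measurable_rVP d (T : measurableType d) n (h : T -> 'rV[R]_n) :
  (forall i, measurable_fun [set: T] (coord_rV i \o h)) ->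
  measurable_fun [set: T] h.
Proof.
move=> mh _ A mA; rewrite setTI; move: A mA.
suff : g_sigma_preimage (@coord_rV R n) `<=`
    [set A | measurable (h @^-1` A)] by [].
apply: smallest_sub.
  split => /=.
  - by rewrite preimage_set0.
  - by move=> A mA; rewrite setTD preimage_setC; exact: measurableC.
  - by move=> F mF; rewrite preimage_bigcup; exact: bigcup_measurable.
move=> A; rewrite -bigcup_seq => -[i _ [B mB <-]] /=.
by rewrite setTI -(setTI (_ @^-1` _)); exact: (mh i).
Qed.

End measurability.

Section push_measure.
Context d1 d2 (T1 : measurableType d1) (T2 : measurableType d2) (R : realType).
Variables (mu : {measure set T1 -> \bar R}) (h : T1 -> T2).
Hypothesis mh : measurable_fun [set: T1] h.

(* [mh] is an argument so that the measure structure can be inferred. *)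
Definition push_measure & measurable_fun [set: T1] h : set T2 -> \bar R :=
  pushforward mu h.

Let push0 : push_measure mh set0 = 0%E.
Proof. by rewrite /push_measure /pushforward preimage_set0 measure0. Qed.

Let push_ge0 A : (0 <= push_measure mh A)%E.
Proof. exact: measure_ge0. Qed.

Let mpre A : measurable A -> measurable (h @^-1` A).
Proof. by move=> mA; rewrite -[X in measurable X]setTI; exact: mh. Qed.

Let push_sigma_additive : semi_sigma_additive (push_measure mh).
Proof.
move=> F mF tF mUF; rewrite /push_measure /pushforward preimage_bigcup.
apply: measure_semi_sigma_additive.
- by move=> i; exact: mpre.
- apply/trivIsetP => /= i j _ _ ij; rewrite -preimage_setI.
  by move/trivIsetP : tF => /(_ _ _ _ _ ij) ->//; rewrite preimage_set0.
- by rewrite -preimage_bigcup; exact: mpre.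
Qed.

HB.instance Definition _ := isMeasure.Build _ _ _ (push_measure mh)
  push0 push_ge0 push_sigma_additive.

End push_measure.

Section lebesgue_measure_rV.
Context {R : realType}.

Definition cons_rV n (p : measurableTypeR R * 'rV[R]_n) : 'rV[R]_n.+1 :=
  row_mx (p.1 : R)%:M p.2.

Definition uncons_rV n (x : 'rV[R]_n.+1) : measurableTypeR R * 'rV[R]_n :=
  (x 0 ord0, \row_i x 0 (lift ord0 i)).

Lemma coord_cons_rV0 n (p : measurableTypeR R * 'rV[R]_n) :
  cons_rV p 0 ord0 = p.1.
Proof.
rewrite /cons_rV (_ : ord0 = lshift n (ord0 : 'I_1)); last exact/val_inj.
by rewrite (row_mxEl (p.1 : R)%:M p.2) mxE eqxx mulr1n.
Qed.

Lemma coord_cons_rVS n (p : measurableTypeR R * 'rV[R]_n) (i : 'I_n) :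
  cons_rV p 0 (lift ord0 i) = p.2 0 i.
Proof.
rewrite /cons_rV (_ : lift ord0 i = rshift 1 i); last exact/val_inj.
by rewrite (row_mxEr (p.1 : R)%:M p.2).
Qed.

Lemma measurable_cons_rV n : measurable_fun setT (@cons_rV n).
Proof.
apply: measurable_rVP => i; case: (unliftP ord0 i) => [j ->|->].
  rewrite (_ : _ \o _ = coord_rV j \o snd); last first.
    by apply/funext => p /=; rewrite /coord_rV coord_cons_rVS.
  by apply: measurableT_comp => //; exact: measurable_coord.
rewrite (_ : _ \o _ = fst); first exact: measurable_fst.
by apply/funext => p /=; rewrite /coord_rV coord_cons_rV0.
Qed.

Lemma measurable_uncons_rV n : measurable_fun setT (@uncons_rV n).
Proof.
apply/measurable_fun_pairP; split; first exact: (measurable_coord ord0).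
apply: measurable_rVP => i; rewrite (_ : _ \o _ = coord_rV (lift ord0 i)).
  exact: measurable_coord.
by apply/funext => x /=; rewrite /coord_rV mxE.
Qed.

Lemma cons_rVK n : cancel (@cons_rV n) (@uncons_rV n).
Proof.
move=> [a v]; rewrite /uncons_rV coord_cons_rV0; congr pair.
by apply/rowP => i; rewrite mxE coord_cons_rVS.
Qed.

Lemma uncons_rVK n : cancel (@uncons_rV n) (@cons_rV n).
Proof.
move=> x; apply/rowP => i; case: (unliftP ord0 i) => [j ->|->].
  by rewrite coord_cons_rVS mxE.
by rewrite coord_cons_rV0.
Qed.

Section step.
Variables (n : nat) (mu : {sigma_finite_measure set 'rV[R]_n -> \bar R}).

Definition lebesgue_rV_step : set 'rV[R]_n.+1 -> \bar R :=
  push_measure (lebesgue_measure \x mu)%E (@measurable_cons_rV n).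

HB.instance Definition _ := Measure.on lebesgue_rV_step.

Let step_sigma_finite : sigma_finite setT lebesgue_rV_step.
Proof.
have /sigma_finiteP[F [TF ndF Foo]] := sigma_finiteT (@lebesgue_measure R).
have /sigma_finiteP[G [TG ndG Goo]] := sigma_finiteT mu.
exists (fun i => @uncons_rV n @^-1` (F i `*` G i)).
  rewrite predeqE => x; split => // _.
  have [i _ Fi] : (\bigcup_i F i) (uncons_rV x).1 by rewrite -TF.
  have [j _ Gj] : (\bigcup_i G i) (uncons_rV x).2 by rewrite -TG.
  exists (maxn i j) => //; split.
    by move: Fi; exact/subsetPset/ndF/leq_maxl.
  by move: Gj; exact/subsetPset/ndG/leq_maxr.
move=> i; have [mF Fi] := Foo i; have [mG Gi] := Goo i; split.
  rewrite -[X in measurable X]setTI; apply: measurable_uncons_rV => //.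
  exact: measurableX.
rewrite /lebesgue_rV_step /push_measure /pushforward -comp_preimage.
rewrite (_ : _ \o _ = id); last by apply/funext => p /=; rewrite cons_rVK.
rewrite preimage_id.
apply: (eq_ind_r (fun x => x < +oo)%E _
  (@product_measure1E _ _ _ _ _ lebesgue_measure mu _ _ mF mG)).
by rewrite lte_mul_pinfty// ge0_fin_numE.
Qed.

HB.instance Definition _ := Measure_isSigmaFinite.Build _ _ _
  lebesgue_rV_step step_sigma_finite.

End step.

(* The Lebesgue measure on R^n: a Dirac mass if n = 0, and the image of
   lebesgue_measure \x lebesgue_rV m under (a, v) |-> (a, v_0, .., v_(m-1))
   if n = m + 1. *)
Fixpoint lebesgue_rV n : {sigma_finite_measure set 'rV[R]_n -> \bar R} :=
  if n is m.+1 then lebesgue_rV_step (lebesgue_rV m)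
  else \d_ (0 : 'rV[R]_0).

End lebesgue_measure_rV.

Section euclidean.
Context {R : realType} {n : nat}.

(* The library norm on 'rV[R]_n is the sup norm. *)
Definition enorm (x : 'rV[R]_n) : R := Num.sqrt (\sum_i x 0 i ^+ 2).

Definition unit_sphere : set 'rV[R]_n := [set x | enorm x = 1].

Definition unit_ball : set 'rV[R]_n := [set x | enorm x <= 1].

Definition punctured_unit_ball : set 'rV[R]_n := [set x | 0 < enorm x <= 1].

Definition radial (x : 'rV[R]_n) : 'rV[R]_n := (enorm x)^-1 *: x.

Lemma measurable_enorm : measurable_fun setT enorm.
Proof.
apply: (@measurableT_comp _ _ _ _ _ _ (@Num.sqrt R)).
  by apply: continuous_measurable_fun; exact: sqrt_continuous.
apply: measurable_sum => i; apply: measurable_funX.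
exact: (measurable_coord i).
Qed.

Lemma measurable_punctured_unit_ball : measurable punctured_unit_ball.
Proof.
rewrite (_ : punctured_unit_ball = setT `&` enorm @^-1` `]0, 1]).
  exact: measurable_enorm.
by apply/seteqP; split => x /=; rewrite in_itv/= => // -[].
Qed.

Lemma measurable_radial : measurable_fun setT radial.
Proof.
apply: measurable_rVP => i.
rewrite (_ : _ \o _ = (fun x => (enorm x)^-1 * (coord_rV i x : R))); last first.
  by apply/funext => x; rewrite /coord_rV /= mxE.
apply: measurable_funM; last exact: measurable_coord.
rewrite (_ : (fun _ => _) = (fun x => powR (enorm x) (-1))); last first.
  by apply/funext => x; rewrite powR_inv1 ?sqrtr_ge0.
exact: measurableT_comp (measurable_powR _) measurable_enorm.
Qed.

End euclidean.
Arguments unit_sphere {R n}.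
Arguments unit_ball {R n}.
Arguments punctured_unit_ball {R n}.

Section surface_measure.
Context {R : realType} {n : nat}.

(* Surface measure on a unit sphere of a d-dimensional space with Lebesgue
   measure lambda, as the measure sigma for which Lebesgue measure reads
   r^(d-1) dr dsigma in polar coordinates, that is
     sigma A = d * lambda {x | 0 < |x| <= 1 /\ x / |x| \in A}.
   For d = 1 each of the two unit vectors has mass 1. *)
Definition surface_measure (d : nat)
    (lambda : {measure set 'rV[R]_n -> \bar R}) : set 'rV[R]_n -> \bar R :=
  push_measure
    (mscale d%:R%:nng (mrestr lambda (@measurable_punctured_unit_ball R n)))
    (@measurable_radial R n).

HB.instance Definition _ d lambda := Measure.on (surface_measure d lambda).

Lemma surface_measureE d lambda A : surface_measure d lambda A =
  (d%:R%:E *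
   lambda [set x | A ((enorm x)^-1 *: x) /\ (0 < enorm x <= 1)]%R)%E.
Proof. by []. Qed.

Definition sphere_measure : set 'rV[R]_n -> \bar R :=
  surface_measure n (lebesgue_rV n).

HB.instance Definition _ := Measure.on sphere_measure.

End surface_measure.

Section subspaces.
Context {R : realType} {n : nat}.

Lemma gram_schmidt m (B : 'M[R]_(m, n)) : row_free B ->
  exists E : 'M[R]_(m, n), E *m E^T = 1%:M /\ (E :=: B)%MS.
Proof.
elim: m B => [|m IHm] B Bfree.
  by exists B; split => //; apply/matrixP => -[].
pose v := usubmx (B : 'M[R]_(1 + m, n)); pose C := dsubmx (B : 'M[R]_(1 + m, n)).
have BE : B = col_mx v C by rewrite vsubmxK.
have [Cfree vC] : row_free C /\ ~~ (v <= C)%MS.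
  have rB : \rank (v + C)%MS = m.+1.
    by rewrite addsmxE -BE; move/eqP: Bfree.
  have rv : (\rank v <= 1)%N by exact: rank_leq_row.
  have rC : (\rank C <= m)%N by exact: rank_leq_row.
  have := mxrank_adds_leqif v C; rewrite rB => -[le _].
  split.
    rewrite /row_free eqn_leq rC -ltnS; apply: leq_trans le _.
    by apply: leq_trans (leq_add rv (leqnn _)) _; rewrite add1n.
  apply/negP => /addsmx_idPr/eqmxP/eqmx_rank; rewrite rB => rE.
  by move: rC; rewrite -rE ltnn.
have [E [EE EC]] := IHm C Cfree.
pose w : 'rV[R]_n := v - v *m E^T *m E.
have wE : w *m E^T = 0 by rewrite mulmxBl -!mulmxA EE mulmx1 subrr.
have w0 : w != 0.
  apply: contra vC; rewrite subr_eq0 => /eqP ->.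
  by rewrite -EC submxMl.
pose s := \sum_i w 0 i ^+ 2.
have wwE : w *m w^T = s%:M.
  apply/matrixP => i j; rewrite !ord1 !mxE eqxx mulr1n.
  by apply: eq_bigr => l _; rewrite [X in _ * X]mxE expr2.
have s0 : 0 < s.
  rewrite lt_neqAle; apply/andP; split; last first.
    by apply: sumr_ge0 => i _; exact: sqr_ge0.
  apply: contra w0 => /eqP/esym s0; apply/eqP/rowP => i; apply/eqP.
  rewrite [X in _ == X]mxE -sqrf_eq0 (psumr_eq0P _ s0)// => j _.
  exact: sqr_ge0.
pose a := (Num.sqrt s)^-1.
have a0 : a != 0 by rewrite invr_neq0// lt0r_neq0// sqrtr_gt0.
suff [FF FB] : col_mx (a *: w) E *m (col_mx (a *: w) E)^T = 1%:M /\
    (col_mx (a *: w) E :=: col_mx v C)%MS.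
  by exists (col_mx (a *: w) E); rewrite BE.
split.
  rewrite tr_col_mx mul_col_row EE -!scalemxAl wE scaler0.
  have -> : E *m (a *: w)^T = 0.
    by apply: trmx_inj; rewrite trmx_mul trmxK trmx0 -scalemxAl wE scaler0.
  rewrite linearZ /= -scalemxAr wwE !scale_scalar_mx scalar_mx_block.
  rewrite (_ : a * (a * s) = 1)// mulrA -expr2 exprVn sqr_sqrtr ?ltW//.
  by rewrite mulVf// lt0r_neq0.
apply: eqmx_trans (eqmx_sym (addsmxE _ _)) _.
apply: eqmx_trans _ (addsmxE _ _); apply/eqmxP/andP; split.
  rewrite addsmx_sub EC addsmxSr andbT scalemx_sub//.
  rewrite addmx_sub ?addsmxSl// -scaleN1r scalemx_sub//.
  by rewrite (submx_trans (submxMl _ _))// EC addsmxSr.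
rewrite addsmx_sub -[in X in _ && X]EC addsmxSr andbT.
rewrite -(subrK (v *m E^T *m E) v) addmx_sub//.
  by rewrite (submx_trans _ (addsmxSl _ _))// eqmx_scale.
by rewrite (submx_trans (submxMl _ _))// addsmxSr.
Qed.

Definition orthonormal_frame (H : {vspace 'rV[R]_n})
    (E : 'M[R]_(\dim H, n)) : Prop :=
  E *m E^T = 1%:M /\ [set` H] = range (fun u : 'rV[R]_(\dim H) => u *m E).

Lemma orthonormal_frame_exists H : exists E, @orthonormal_frame H E.
Proof.
pose B : 'M[R]_(\dim H, n) := \matrix_i (vbasis H)`_i.
have uB u : u *m B = \sum_i u 0 i *: (vbasis H)`_i.
  by rewrite mulmx_sum_row; apply: eq_bigr => i _; rewrite rowK.
have Bfree : row_free B.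
  apply/row_freeP; apply/row_freeP/inj_row_free => u; rewrite uB => u0.
  have /freeP fB := basis_free (vbasisP H).
  by apply/rowP => i; rewrite mxE (fB (u 0) u0).
have [E [EE EB]] := gram_schmidt Bfree.
exists E; split => //; apply/seteqP; split => x /=.
  move=> /coord_vbasis xE.
  have xB : x = (\row_i coord (vbasis H) i x) *m B.
    by rewrite uB [LHS]xE; apply: eq_bigr => i _; rewrite mxE.
  have : (x <= E)%MS by rewrite EB xB submxMl.
  by move=> /submxP[u ->]; exists u.
move=> [u _ <-]; have : (u *m E <= B)%MS by rewrite -EB submxMl.
move=> /submxP[w ->]; rewrite uB; apply: memv_suml => i _; apply: memvZ.
by apply/vbasis_mem/mem_nth; rewrite size_tuple.
Qed.

Definition frame (H : {vspace 'rV[R]_n}) : 'M[R]_(\dim H, n) :=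
  projT1 (cid (orthonormal_frame_exists H)).

Lemma frameP H : orthonormal_frame (frame H).
Proof. exact: projT2 (cid _). Qed.

Lemma measurable_mulmxr m (E : 'M[R]_(m, n)) :
  measurable_fun setT (fun u : 'rV[R]_m => u *m E).
Proof.
apply: measurable_rVP => i.
rewrite (_ : _ \o _ = (fun u => \sum_j (coord_rV j u : R) * E j i)); last first.
  by apply/funext => u; rewrite /coord_rV /= mxE.
apply: measurable_sum => j; apply: measurable_funM => //.
exact: measurable_coord.
Qed.

(* (dim H)-dimensional Lebesgue measure on H, as a measure on R^n supported by
   H: the image of Lebesgue measure under a linear isometry from R^(dim H) onto
   H, which does not depend on the isometry. *)
Definition lebesgue_subspace (H : {vspace 'rV[R]_n}) :
    set 'rV[R]_n -> \bar R :=
  push_measure (lebesgue_rV (\dim H)) (measurable_mulmxr (frame H)).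

HB.instance Definition _ H := Measure.on (lebesgue_subspace H).

Definition subsphere_measure (H : {vspace 'rV[R]_n}) :
    set 'rV[R]_n -> \bar R :=
  surface_measure (\dim H) (lebesgue_subspace H).

HB.instance Definition _ H := Measure.on (subsphere_measure H).

End subspaces.

Definition grassmannian (R : realType) (n m : nat) : Type :=
  {H : {vspace 'rV[R]_n} | \dim H == m}.

HB.instance Definition _ (R : realType) n m :=
  Choice.on (grassmannian R n m).

Section generalized_intersection_bodies.
Context {R : realType} {n : nat}.
Implicit Types (K : set 'rV[R]_n) (g : 'rV[R]_n -> R).

(* C(S^(n-1)) is rendered as the functions on R^n whose restriction to the
   sphere is continuous; the integrals below only see that restriction. *)
Definition sphere_continuous : set ('rV[R]_n -> R) :=
  [set g | {within unit_sphere, continuous g}].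

Definition spherical_radon (m : nat) g (H : grassmannian R n m) : R :=
  \int[subsphere_measure (val H)]_(x in unit_sphere `&` [set` val H]) g x.

Definition radon_range (m : nat) : set {uniform grassmannian R n m -> R} :=
  @spherical_radon m @` sphere_continuous.

(* The space M^+(X) for X = radon_range m. A functional on X is represented by
   a function defined on all functions on the Grassmannian, of which only the
   values on X are constrained or used. The topology of uniform convergence
   restricted to X is that of the sup norm. *)
Definition positive_functional (m : nat)
    (nu : {uniform grassmannian R n m -> R} -> R) : Prop :=
  [/\ {within @radon_range m, continuous nu},
      forall (a : R) h1 h2, radon_range h1 -> radon_range h2 ->
        nu (fun H => a * h1 H + h2 H) = a * nu h1 + nu h2
    & forall h, radon_range h -> (forall H, 0 <= h H) -> 0 <= nu h].

Definition line_through (x : 'rV[R]_n) : set 'rV[R]_n :=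
  range (fun t : R => t *: x).

Definition boundary K : set 'rV[R]_n := closure K `\` K^°.

(* The infimum is a minimum as soon as K is closed and bounded with the origin
   in its interior. *)
Definition minkowski_functional K (x : 'rV[R]_n) : R :=
  inf [set a : R | 0 <= a /\ exists2 y, K y & x = a *: y].

Definition star_body K : Prop :=
  [/\ closed K /\ bounded_set K,
      forall x, x != 0 -> exists p q, p != q /\
        [set y | y != 0 /\ (line_through x `&` boundary K) y] = [set p; q],
      K^° 0
    & continuous (minkowski_functional K)].

Definition origin_symmetric K : Prop := [set - x | x in K] = K.

Definition generalized_intersection_body (k : nat) K : Prop :=
  [/\ star_body K, origin_symmetric K
    & exists nu : {uniform grassmannian R n (n - k) -> R} -> R,
        positive_functional nu /\
        forall g, sphere_continuous g ->
          \int[sphere_measure]_(x in unit_sphere)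
            (minkowski_functional K x ^- k * g x)
          = nu (@spherical_radon (n - k) g)].

End generalized_intersection_bodies.

(* mu(B) for the measure mu with density f with respect to lambda, where lambda
   is Lebesgue measure on R^n or on a subspace. *)
Definition density_measure (R : realType) (n : nat)
    (lambda : {measure set 'rV[R]_n -> \bar R}) (f : 'rV[R]_n -> R)
    (B : set 'rV[R]_n) : \bar R :=
  (\int[lambda]_(x in B) (f x)%:E)%E.

Definition section_measure (R : realType) (n m : nat) (f : 'rV[R]_n -> R)
    (B : set 'rV[R]_n) (H : grassmannian R n m) : \bar R :=
  density_measure (lebesgue_subspace (val H)) f (B `&` [set` val H]).

Definition ball_volume (R : realType) (m : nat) : R :=
  fine (lebesgue_rV m (@unit_ball R m)).

Definition c_const (R : realType) (n k : nat) : R :=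
  ball_volume R n `^ ((n - k)%:R / n%:R) / ball_volume R (n - k).

(* Main.v *)
Require Import Defs.
From mathcomp Require Import all_boot all_order all_algebra.
From mathcomp Require Import all_classical all_reals all_analysis.
From mathcomp Require Import measurable_realfun ring.

(** Let rho be the radial function of K, let m = n - k, and for a unit vector x
    let G(x) be the integral of t^(m-1) f(t x) over 0 <= t <= rho(x). In polar
    coordinates of a subspace H of dimension m, the measure of the section of K
    by H is the spherical Radon transform of G at H (section_radon), while the
    transform of the constant 1 is the area m |B^m| of the unit sphere of H.
    Hence, if M is the maximal section measure and c = M / (m |B^m|), the
    continuous function c - G has a non-negative Radon transform. A positive
    functional nu that represents integration against rho^k is therefore
    non-negative there, which means that the integral of rho^k G over the
    sphere is at most c times the integral of rho^k (weighted_ray_integral_le).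

    Both sides are then compared with the quantities of the theorem. As
    t^k <= rho(x)^k along the ray, rho(x)^k G(x) dominates the integral of
    t^(n-1) f(t x), whose integral over the sphere is mu(K)
    (density_measure_le). On the other side Hoelder's inequality bounds the
    integral of rho^k by |S|^(m/n) (n Vol(K))^(k/n), because the integral of
    rho^n is n Vol(K) (radial_moment_le). With |S| = n |B^n| the powers of n
    combine to a single factor n.

    Three facts carry this argument.
    - Polar coordinates (polar_coordinates): the surface measure is defined
      from cones over subsets of the sphere, and the formula follows from
      Tonelli's theorem and the homogeneity of Lebesgue measure.
    - Lebesgue measure on H does not depend on the orthonormal frame that
      defines it (ge0_integral_frame). This is the invariance of Lebesgue
      measure under orthogonal maps (ge0_integral_rV_orthogonal), which is
      deduced from translation invariance as in the uniqueness of Haar measure.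
    - The maximum exists (section_measure_max): the section measure is a
      continuous function on the compact set of orthonormal frames. Continuity
      rests on that of G away from the origin, hence on the continuity of the
      Minkowski functional, and on the fact that a star body is the set of
      points t x with 0 <= t <= rho(x) (star_bodyP). *)

Set Implicit Arguments.
Unset Strict Implicit.
Unset Printing Implicit Defensive.

Import Order.TTheory GRing.Theory Num.Theory.
Import numFieldNormedType.Exports.

Local Open Scope classical_set_scope.
Local Open Scope ring_scope.

(** * Borel measurability in R^n *)

Section measurability.
Context {R : realType}.

Lemma mx_norm_lt n (x : 'rV[R]_n) (r : R) : 0 < r ->
  (`|x| < r) <-> (forall i, `|x 0 i| < r).
Proof.
move=> r0; have xr : ball (0 : 'rV[R]_n) r x <-> `|x| < r.
  by rewrite mx_norm_ball /ball_/= sub0r normrN.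
rewrite -xr; split.
  by move=> -[_ +] i => /(_ 0 i); rewrite /ball/= mxE sub0r normrN.
move=> h; split => // i j; rewrite ord1 /ball/= mxE sub0r normrN.
exact: h.
Qed.

Lemma measurable_ball_rV n (q : 'rV[R]_n) (r : R) : measurable (ball q r).
Proof.
have [r0|r0] := ltP 0 r; last first.
  rewrite (_ : ball q r = set0)// -subset0 mx_norm_ball => x /=.
  by rewrite ltNge (le_trans r0).
rewrite (_ : ball q r =
    \bigcap_(i in [set: 'I_n]) (@coord_rV R n i @^-1` (ball (q 0 i) r))).
  apply: fin_bigcap_measurable => // i _; rewrite -[X in measurable X]setTI.
  exact: (@measurable_coord R n i measurableT _ (measurable_ball _ _)).
rewrite mx_norm_ball; apply/seteqP; split => x /=.
  by move=> /(mx_norm_lt _ r0) h i _; have := h i; rewrite !mxE.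
by move=> h; apply/(mx_norm_lt _ r0) => i; rewrite !mxE; exact: h.
Qed.

(** An open set is a countable union of balls with rational centre and radius
    1/(j+1): only the balls that it contains are kept. *)
Lemma open_measurable_rV n (U : set 'rV[R]_n) : open U -> measurable U.
Proof.
move=> oU.
pose B (p : 'rV[rat]_n * nat) : set 'rV[R]_n :=
  ball (map_mx (@ratr R) p.1 : 'rV[R]_n) p.2.+1%:R^-1.
pose F p := if `[< B p `<=` U >] then B p else set0.
have -> : U = \bigcup_p F p.
  apply/seteqP; split => x; last first.
    by move=> [p _]; rewrite /F; case: asboolP => // pU /pU.
  move=> Ux; have /nbhs_ballP[e /= e0 eU] := open_nbhs_nbhs (conj oU Ux).
  have [j je] : exists j : nat, j.+1%:R^-1 < e / 2.
    have e20 : 0 < e / 2 by rewrite divr_gt0.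
    have [N _ /(_ N (leqnn N)) h] := near_infty_natSinv_lt (PosNum e20).
    by exists N.
  have j0 : 0 < (j.+1%:R^-1 : R) by rewrite invr_gt0.
  have : forall i, exists q : rat, `|ratr q - x 0 i| < j.+1%:R^-1.
    move=> i; have [|q] := @rat_in_itvoo R (x 0 i - j.+1%:R^-1) (x 0 i + j.+1%:R^-1).
      by rewrite ltrBlDr -addrA ltrDl addr_gt0.
    by rewrite in_itv/= => qx; exists q; rewrite ltr_distl qx.
  move=> /choice[q qx]; exists (\row_i q i, j) => //; rewrite /F.
  have Bx : B (\row_i q i, j) x.
    rewrite /B mx_norm_ball /ball_/=; apply/(mx_norm_lt _ j0) => i.
    by rewrite !mxE.
  case: asboolP => // -[] y By; apply: eU.
  rewrite (splitr e).
  apply: (@ball_triangle _ _ (map_mx (@ratr R) (\row_i q i) : 'rV[R]_n)).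
    by apply: ball_sym; apply: le_ball Bx; exact: ltW.
  by apply: le_ball By; exact: ltW.
apply: countable_bigcupT_measurable => // p; rewrite /F.
case: asboolP => [_|_]; [exact: measurable_ball_rV|exact: measurable0].
Qed.

Lemma closed_measurable_rV n (U : set 'rV[R]_n) : closed U -> measurable U.
Proof.
move=> cU; rewrite -[U]setCK; apply: measurableC; apply: open_measurable_rV.
exact: closed_openC.
Qed.

Lemma open_continuous_measurable_rV n (D : set 'rV[R]_n) (f : 'rV[R]_n -> R) :
  open D -> {in D, continuous f} -> measurable_fun D f.
Proof.
move=> oD /(continuous_inP f oD) cf; apply: (measurability _ (RGenOInfty.measurableE R)).
by move=> _ [_ [a ->] <-]; apply: open_measurable_rV; exact/cf/interval_open.
Qed.

Lemma continuous_measurable_rV n (f : 'rV[R]_n -> R) :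
  continuous f -> measurable_fun setT f.
Proof.
by move=> cf; apply: open_continuous_measurable_rV => [|x _ //]; exact: openT.
Qed.

Lemma measurable_addrV n :
  measurable_fun setT (fun p : 'rV[R]_n * 'rV[R]_n => p.1 + p.2).
Proof.
apply: measurable_rVP => i.
rewrite (_ : _ \o _ = (fun p => (coord_rV i p.1 : R) + (coord_rV i p.2 : R))).
  apply: measurable_funD; apply: measurableT_comp => //;
  exact: measurable_coord.
by apply/funext => p; rewrite /coord_rV /= mxE.
Qed.

Lemma measurable_opprV n : measurable_fun setT (fun x : 'rV[R]_n => - x).
Proof.
apply: measurable_rVP => i.
rewrite (_ : _ \o _ = (fun x => - (coord_rV i x : R))).
  apply: measurableT_comp => //; exact: measurable_coord.
by apply/funext => p; rewrite /coord_rV /= mxE.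
Qed.

Lemma measurable_scalerV n :
  measurable_fun setT (fun p : R * 'rV[R]_n => p.1 *: p.2).
Proof.
apply: measurable_rVP => i.
rewrite (_ : _ \o _ = (fun p => p.1 * (coord_rV i p.2 : R))).
  apply: measurable_funM => //; apply: measurableT_comp => //.
  exact: measurable_coord.
by apply/funext => p; rewrite /coord_rV /= mxE.
Qed.

Lemma measurable_funD_rV d (T : measurableType d) n (f g : T -> 'rV[R]_n) :
  measurable_fun setT f -> measurable_fun setT g ->
  measurable_fun setT (fun x => f x + g x).
Proof.
move=> mf mg; have mfg : measurable_fun setT (fun x => (f x, g x)).
  exact/measurable_fun_pairP.
exact: (measurableT_comp (@measurable_addrV n) mfg).
Qed.

Lemma measurable_funZ_rV d (T : measurableType d) n (f : T -> R) (g : T -> 'rV[R]_n) :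
  measurable_fun setT f -> measurable_fun setT g ->
  measurable_fun setT (fun x => f x *: g x).
Proof.
move=> mf mg; have mfg : measurable_fun setT (fun x => (f x, g x)).
  exact/measurable_fun_pairP.
exact: (measurableT_comp (@measurable_scalerV n) mfg).
Qed.

End measurability.

(** * Lebesgue measure on R^n *)

Section lebesgue_R.
Context {R : realType}.
Local Notation leb := (@lebesgue_measure R).
Local Open Scope ereal_scope.

Lemma preimage_addr_itv (a b c : R) :
  (fun x : R => (x + c)%R) @^-1` `]a, b]%classic = `](a - c)%R, (b - c)%R]%classic.
Proof.
by apply/seteqP; split => x /=; rewrite !in_itv/= ltrBlDr lerBrDr.
Qed.

Lemma preimage_mulr_itv (a b r : R) : (0 < r)%R ->
  (fun x : R => (r * x)%R) @^-1` `]a, b]%classic = `](a / r)%R, (b / r)%R]%classic.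
Proof.
move=> r0; apply/seteqP; split => x /=; rewrite !in_itv/=;
  by rewrite ltr_pdivrMr// ler_pdivlMr// mulrC.
Qed.

Lemma ge0_integral_shift (c : R) (g : R -> \bar R) :
  measurable_fun setT g -> (forall x, 0 <= g x) ->
  \int[leb]_x g (x + c)%R = \int[leb]_x g x.
Proof.
move=> mg g0.
have mc : measurable_fun setT
    ((fun x => x + c)%R : measurableTypeR R -> measurableTypeR R).
  exact: measurable_funD.
transitivity (\int[push_measure leb mc]_x g x).
  by rewrite (@ge0_integral_pushforward _ _ _ _ _ _ mc)// => ? _; exact: g0.
apply: eq_measure_integral => A mA _; apply/esym.
apply: (lebesgue_measure_unique (mu := push_measure leb mc)) => //.
move=> _ [[a b] _ <-]; rewrite /push_measure /pushforward.
rewrite [X in _ = leb X](_ : _ = `](a - c)%R, (b - c)%R]%classic); last first.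
  exact: preimage_addr_itv.
rewrite !lebesgue_measure_itv/= !lte_fin ltrD2r -!EFinB.
by rewrite opprB addrA subrK.
Qed.

Lemma ge0_integral_scale (r : R) (g : R -> \bar R) : (0 < r)%R ->
  measurable_fun setT g -> (forall x, 0 <= g x) ->
  r%:E * \int[leb]_x g (r * x)%R = \int[leb]_x g x.
Proof.
move=> r0 mg g0.
have mc : measurable_fun setT
    ((fun x => r * x)%R : measurableTypeR R -> measurableTypeR R).
  exact: measurable_funM.
transitivity (\int[mscale (NngNum (ltW r0)) (push_measure leb mc)]_x g x).
  rewrite ge0_integral_mscale//; congr (_ * _).
  by rewrite (@ge0_integral_pushforward _ _ _ _ _ _ mc)// => ? _; exact: g0.
apply: eq_measure_integral => A mA _; apply/esym.
apply: (lebesgue_measure_unique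
  (mu := mscale (NngNum (ltW r0)) (push_measure leb mc))) => //.
move=> _ [[a b] _ <-]; rewrite /mscale/= /push_measure /pushforward.
rewrite [X in _ = (_ * leb X)](_ : _ = `](a / r)%R, (b / r)%R]%classic); last first.
  exact: preimage_mulr_itv.
rewrite !lebesgue_measure_itv/= !lte_fin.
rewrite ltr_pM2r ?invr_gt0//; case: ifPn => ab; last by rewrite mule0.
by rewrite -!EFinB -EFinM; congr EFin; field; rewrite gt_eqF.
Qed.

End lebesgue_R.

Section lebesgue_rV.
Context {R : realType}.
Local Open Scope ereal_scope.
Local Notation leb := (@lebesgue_measure R).

Lemma measurable_fun_cons_rV n (h : 'rV[R]_n.+1 -> \bar R) :
  measurable_fun setT h -> measurable_fun setT (h \o @cons_rV R n).
Proof. by move=> mh; apply: measurableT_comp mh (@measurable_cons_rV R n). Qed.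

Lemma ge0_integral_lebesgue_rVS n (h : 'rV[R]_n.+1 -> \bar R) :
  measurable_fun setT h -> (forall x, 0 <= h x) ->
  \int[lebesgue_rV n.+1]_x h x =
  \int[leb]_a \int[lebesgue_rV n]_v h (cons_rV (a, v)).
Proof.
move=> mh h0.
rewrite (@ge0_integral_pushforward _ _ _ _ _ _ (@measurable_cons_rV R n))//.
rewrite -(fubini_tonelli1 (h \o @cons_rV R n))// ?preimage_setT//.
- exact: measurable_fun_cons_rV.
- by move=> x; exact: h0.
Qed.

Lemma cons_rVD n (a b : R) (v w : 'rV[R]_n) :
  (cons_rV (a, v) + cons_rV (b, w) = cons_rV ((a + b)%R : measurableTypeR R, v + w))%R.
Proof.
apply/rowP => i; case: (unliftP ord0 i) => [j ->|->].
  by rewrite mxE !coord_cons_rVS !mxE.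
by rewrite mxE !coord_cons_rV0.
Qed.

Lemma cons_rVZ n (r a : R) (v : 'rV[R]_n) :
  (r *: cons_rV (a, v) = cons_rV ((r * a)%R : measurableTypeR R, r *: v))%R.
Proof.
apply/rowP => i; case: (unliftP ord0 i) => [j ->|->].
  by rewrite mxE !coord_cons_rVS !mxE.
by rewrite mxE !coord_cons_rV0.
Qed.

Lemma measurable_addr_rV n (c : 'rV[R]_n) :
  measurable_fun setT (fun x : 'rV[R]_n => x + c)%R.
Proof. exact: (measurable_fun_pair1 c (@measurable_addrV R n)). Qed.

Lemma measurable_scale_rV n (r : R) :
  measurable_fun setT (fun x : 'rV[R]_n => r *: x)%R.
Proof. exact: (measurable_fun_pair2 r (@measurable_scalerV R n)). Qed.

Lemma ge0_integral_rV_shift n (c : 'rV[R]_n) (h : 'rV[R]_n -> \bar R) :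
  measurable_fun setT h -> (forall x, 0 <= h x) ->
  \int[lebesgue_rV n]_x h (x + c)%R = \int[lebesgue_rV n]_x h x.
Proof.
elim: n c h => [|n IH] c h mh h0.
  by apply: eq_integral => x _; congr h; apply/rowP => -[].
rewrite (ge0_integral_lebesgue_rVS mh h0).
rewrite (ge0_integral_lebesgue_rVS
  (measurableT_comp mh (measurable_addr_rV c)) (fun=> h0 _)).
have mhc : measurable_fun setT (h \o @cons_rV R n).
  exact: measurable_fun_cons_rV.
rewrite -[RHS](ge0_integral_shift (uncons_rV c).1); last 2 first.
- exact: (measurable_fun_fubini_tonelli_F (h \o @cons_rV R n) mhc (fun=> h0 _)).
- by move=> a; apply: integral_ge0.
apply: eq_integral => a _; rewrite -[RHS](IH (uncons_rV c).2)//.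
  by apply: eq_integral => v _ /=; rewrite -[in LHS](uncons_rVK c) cons_rVD.
exact: (measurable_fun_pair2 _ mhc).
Qed.

Lemma ge0_integral_rV_scale n (r : R) (h : 'rV[R]_n -> \bar R) : (0 < r)%R ->
  measurable_fun setT h -> (forall x, 0 <= h x) ->
  (r ^+ n)%:E * \int[lebesgue_rV n]_x h (r *: x)%R = \int[lebesgue_rV n]_x h x.
Proof.
move=> r0; elim: n h => [|n IH] h mh h0.
  by rewrite expr0 mul1e; apply: eq_integral => x _; congr h; apply/rowP => -[].
rewrite (ge0_integral_lebesgue_rVS mh h0).
rewrite (ge0_integral_lebesgue_rVS
  (measurableT_comp mh (@measurable_scale_rV _ r)) (fun=> h0 _)).
have mhc : measurable_fun setT (h \o @cons_rV R n).
  exact: measurable_fun_cons_rV.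
have mF : measurable_fun setT (fun a => \int[lebesgue_rV n]_v h (cons_rV (a, v))).
  exact: (measurable_fun_fubini_tonelli_F (h \o @cons_rV R n) mhc (fun=> h0 _)).
rewrite -(ge0_integral_scale r0 mF); last by move=> a; apply: integral_ge0.
rewrite exprS EFinM -muleA; congr (_ * _).
rewrite -ge0_integralZl//; last 3 first.
- have mhr := measurable_fun_cons_rV (measurableT_comp mh (@measurable_scale_rV n.+1 r)).
  exact: (measurable_fun_fubini_tonelli_F _ mhr (fun=> h0 _)).
- by move=> a _; apply: integral_ge0 => v _; exact: h0.
- by rewrite lee_fin exprn_ge0// ltW.
apply: eq_integral => a _; rewrite -(IH (fun v => h (cons_rV (r * a, v)%R)))//.
  by congr (_ * _); apply: eq_integral => v _ /=; rewrite cons_rVZ.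
exact: (measurable_fun_pair2 _ mhc).
Qed.

End lebesgue_rV.

Section enorm.
Context {R : realType}.

Lemma cvg_bigsum (T I : Type) (F : set_system T) {FF : Filter F} (r : seq I)
    (f : I -> T -> R) (l : I -> R) :
  (forall i, f i @ F --> l i) ->
  (\sum_(i <- r) f i x) @[x --> F] --> \sum_(i <- r) l i.
Proof.
move=> fl; elim: r => [|i r IH].
  by rewrite big_nil; under eq_fun do rewrite big_nil; exact: cvg_cst.
rewrite big_cons; under eq_fun do rewrite big_cons.
exact: cvgD.
Qed.

Lemma enorm_ge0 n (x : 'rV[R]_n) : 0 <= enorm x.
Proof. exact: sqrtr_ge0. Qed.

Lemma sum_sqr_ge0 n (x : 'rV[R]_n) : 0 <= \sum_i x 0 i ^+ 2.
Proof. by apply: sumr_ge0 => i _; exact: sqr_ge0. Qed.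

Lemma enormZ n (r : R) (x : 'rV[R]_n) : enorm (r *: x) = `|r| * enorm x.
Proof.
rewrite /enorm; under eq_bigr do rewrite mxE exprMn.
by rewrite -mulr_sumr sqrtrM ?sqr_ge0// sqrtr_sqr.
Qed.

Lemma enormN n (x : 'rV[R]_n) : enorm (- x) = enorm x.
Proof. by rewrite -scaleN1r enormZ normrN1 mul1r. Qed.

Lemma enorm0 n : enorm (0 : 'rV[R]_n) = 0.
Proof. by rewrite -(scale0r 0) enormZ normr0 mul0r. Qed.

Lemma le_coord_enorm n (x : 'rV[R]_n) i : `|x 0 i| <= enorm x.
Proof.
rewrite -sqrtr_sqr ler_sqrt ?sum_sqr_ge0// (bigD1 i)//= lerDl.
by apply: sumr_ge0 => j _; exact: sqr_ge0.
Qed.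

Lemma enorm_eq0 n (x : 'rV[R]_n) : (enorm x == 0) = (x == 0).
Proof.
apply/eqP/eqP => [x0|->]; last exact: enorm0.
apply/rowP => i; apply/eqP; rewrite mxE -normr_le0 -x0.
exact: le_coord_enorm.
Qed.

Lemma enorm_gt0 n (x : 'rV[R]_n) : (0 < enorm x) = (x != 0).
Proof. by rewrite lt0r enorm_eq0 enorm_ge0 andbT. Qed.

Lemma enorm_sqr n (x : 'rV[R]_n) : (x *m x^T) 0 0 = enorm x ^+ 2.
Proof.
rewrite sqr_sqrtr ?sum_sqr_ge0// mxE.
by apply: eq_bigr => i _; rewrite [X in _ * X]mxE expr2.
Qed.

Lemma enorm_mulmx m n (E : 'M[R]_(m, n)) (u : 'rV[R]_m) :
  E *m E^T = 1%:M -> enorm (u *m E) = enorm u.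
Proof.
move=> EE; apply/eqP; rewrite -(@eqrXn2 _ 2)// ?enorm_ge0//.
by rewrite -!enorm_sqr trmx_mul mulmxA -(mulmxA u) EE mulmx1.
Qed.

Lemma continuous_enorm n : continuous (@enorm R n).
Proof.
have cS : continuous (fun x : 'rV[R]_n => \sum_i x 0 i ^+ 2).
  move=> x; apply: (@cvg_bigsum _ _ (nbhs x)) => i.
  apply: (@continuous_comp _ _ _ (fun x : 'rV[R]_n => x 0 i) (fun r => r ^+ 2)).
    exact: coord_continuous.
  exact: exprn_continuous.
by move=> x; apply: (continuous_comp (cS x)); exact: sqrt_continuous.
Qed.

Lemma le_norm_enorm n (x : 'rV[R]_n) : `|x| <= enorm x.
Proof.
apply/ler_addgt0Pr => e e0; apply/ltW/mx_norm_lt; first by rewrite ltr_wpDl ?enorm_ge0.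
by move=> i; rewrite (le_lt_trans (le_coord_enorm x i))// ltrDl.
Qed.

Lemma enorm_radial n (x : 'rV[R]_n) : x != 0 -> enorm (radial x) = 1.
Proof.
move=> x0; rewrite /radial enormZ ger0_norm ?invr_ge0 ?enorm_ge0//.
by rewrite mulVf// enorm_eq0.
Qed.

End enorm.

Section ball_volume.
Context {R : realType}.
Local Open Scope ereal_scope.
Local Notation leb := (@lebesgue_measure R).

Lemma measurable_unit_ball n : measurable (@unit_ball R n).
Proof.
rewrite (_ : unit_ball = setT `&` enorm @^-1` `]-oo, 1%R]).
  exact: measurable_enorm.
by apply/seteqP; split => x /=; rewrite in_itv/= => // -[].
Qed.

Lemma lebesgue_rV_preimage_scale n (r : R) (A : set 'rV[R]_n) : (0 < r)%R ->
  measurable A ->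
  (r ^+ n)%:E * lebesgue_rV n ((fun x => r *: x)%R @^-1` A) = lebesgue_rV n A.
Proof.
move=> r0 mA; rewrite -[in RHS](setIT A) -integral_indic//.
rewrite -(ge0_integral_rV_scale r0)//; last exact/measurable_EFinP/measurable_indic.
congr (_ * _).
rewrite (_ : (fun x => _) =
  fun x => (\1_((fun x : 'rV[R]_n => r *: x)%R @^-1` A) x)%:E)//.
rewrite integral_indic// ?setIT// -[X in measurable X]setTI.
exact: measurable_scale_rV.
Qed.

Lemma lebesgue_rV_setT_neq0 n : lebesgue_rV n [set: 'rV[R]_n] != 0.
Proof.
elim: n => [|n IH]; first by rewrite /= diracT oner_neq0.
have -> : lebesgue_rV n.+1 [set: 'rV[R]_n.+1] =
    (leb \x lebesgue_rV n) (setT `*` setT).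
  by rewrite /= /lebesgue_rV_step /push_measure /pushforward preimage_setT setXTT.
rewrite product_measure1E// mule_neq0//.
suff leby : leb setT = +oo.
  by apply/eqP => leb0; have : leb setT = 0 by []; rewrite leby.
transitivity (leb `]-oo, +oo[%classic); last by rewrite lebesgue_measure_itv.
by congr (leb _); apply/seteqP; split.
Qed.

Lemma measurable_cube n :
  measurable [set x : 'rV[R]_n | forall i, (`|x ord0 i| <= 1)%R].
Proof.
rewrite (_ : mkset _ = \bigcap_(i in [set: 'I_n]) (@coord_rV R n i @^-1` `[(-1)%R, 1%R])).
  apply: fin_bigcap_measurable => // i _; rewrite -[X in measurable X]setTI.
  exact: (@measurable_coord R n i measurableT _ (measurable_itv _)).
apply/seteqP; split => x /= h.
  by move=> i _ /=; rewrite in_itv/= -ler_norml; exact: h.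
by move=> i; have := h i Logic.I; rewrite /= in_itv/= -ler_norml.
Qed.

Lemma lebesgue_rV_cube_lty n :
  lebesgue_rV n [set x : 'rV[R]_n | forall i, (`|x ord0 i| <= 1)%R] < +oo.
Proof.
elim: n => [|n IH].
  apply: (@le_lt_trans _ _ 1); last by rewrite ltry.
  by rewrite /= /dirac indicE lee_fin lern1 leq_b1.
have mC := @measurable_cube n.
have -> : lebesgue_rV n.+1 [set x : 'rV[R]_n.+1 | forall i, (`|x ord0 i| <= 1)%R] =
    (leb \x lebesgue_rV n) (`[(-1)%R, 1%R] `*`
      [set x : 'rV[R]_n | forall i, (`|x ord0 i| <= 1)%R]).
  rewrite /= /lebesgue_rV_step /push_measure /pushforward; congr (_ _).
  apply/seteqP; split => -[a v] /=.
    move=> h; split.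
      by have := h ord0; rewrite coord_cons_rV0/= in_itv/= -ler_norml.
    by move=> i; have := h (lift ord0 i); rewrite coord_cons_rVS.
  rewrite in_itv/= -ler_norml => -[h1 h2] i.
  by case: (unliftP ord0 i) => [j ->|->]; rewrite ?coord_cons_rVS ?coord_cons_rV0.
have I_fin : leb `[(-1)%R, 1%R] \is a fin_num.
  by rewrite lebesgue_measure_itv/=; case: ifP.
by rewrite product_measure1E// lte_mul_pinfty.
Qed.

Lemma lebesgue_rV_unit_ball_lty n : lebesgue_rV n (@unit_ball R n) < +oo.
Proof.
apply: le_lt_trans (lebesgue_rV_cube_lty n); apply: le_measure; rewrite ?inE.
- exact: measurable_unit_ball.
- exact: measurable_cube.
- by move=> x /= h i; rewrite (le_trans (le_coord_enorm x i)).
Qed.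

(** The dilates of a null ball would be null, and they cover the space. *)
Lemma lebesgue_rV_unit_ball_gt0 n : 0 < lebesgue_rV n (@unit_ball R n).
Proof.
rewrite lt0e measure_ge0 andbT; apply/negP => /eqP B0.
have := lebesgue_rV_setT_neq0 n; apply/negP; rewrite negbK.
pose F j := (fun x : 'rV[R]_n => j.+1%:R^-1 *: x)%R @^-1` unit_ball.
have mF j : measurable (F j).
  rewrite -[X in measurable X]setTI; apply: measurable_scale_rV => //.
  exact: measurable_unit_ball.
apply/eqP/negligibleP => //; rewrite (_ : setT = \bigcup_j F j).
  apply: negligible_bigcup => j; apply/negligibleP => //.
  have j0 : (0 < j.+1%:R^-1 :> R)%R by rewrite invr_gt0.
  have := lebesgue_rV_preimage_scale j0 (@measurable_unit_ball n).
  rewrite B0 => /eqP; rewrite mule_eq0 => /orP[|/eqP//].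
  by rewrite eqe gt_eqF// exprn_gt0.
apply/seteqP; split => // x _; exists (Num.truncn (enorm x)) => //.
rewrite /F /= /unit_ball/= enormZ ger0_norm ?invr_ge0// mulrC ler_pdivrMr// mul1r.
by rewrite ltW// truncnS_gt.
Qed.

Lemma lebesgue_rV_unit_ball_fin_num n :
  lebesgue_rV n (@unit_ball R n) \is a fin_num.
Proof.
move: (lebesgue_rV_unit_ball_lty n) (lebesgue_rV_unit_ball_gt0 n).
by move: (lebesgue_rV n _) => v vy v0; rewrite gt0_fin_numE.
Qed.

Lemma measurable_unit_sphere n : measurable (@unit_sphere R n).
Proof.
rewrite (_ : unit_sphere = setT `&` enorm @^-1` [set 1%R]).
  exact: measurable_enorm.
by apply/seteqP; split => x //= -[].
Qed.

Lemma measurable_origin n : measurable [set 0%R : 'rV[R]_n].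
Proof.
rewrite (_ : [set 0%R] = setT `&` enorm @^-1` [set 0%R]).
  exact: measurable_enorm.
apply/seteqP; split => x /=; first by move=> ->; rewrite enorm0.
by move=> [_ /eqP]; rewrite enorm_eq0 => /eqP.
Qed.

(** The dilation by 2 fixes the origin and multiplies the measure by 2^n > 1. *)
Lemma lebesgue_rV_origin n : (0 < n)%N -> lebesgue_rV n [set 0%R : 'rV[R]_n] = 0.
Proof.
move=> n0; have m0 : measurable [set 0%R : 'rV[R]_n].
  exact: measurable_origin.
have lt0y : lebesgue_rV n [set 0%R : 'rV[R]_n] < +oo.
  apply: le_lt_trans (lebesgue_rV_unit_ball_lty n); apply: le_measure; rewrite ?inE//.
    exact: measurable_unit_ball.
  by move=> _ ->; rewrite /unit_ball/= enorm0.
have := lebesgue_rV_preimage_scale (ltr0Sn R 1) m0.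
rewrite (_ : _ @^-1` _ = [set 0%R]); last first.
  apply/seteqP; split => x /=; last by move=> ->; rewrite scaler0.
  by move=> /eqP; rewrite scaler_eq0 pnatr_eq0 => /eqP.
rewrite -(@fineK _ (lebesgue_rV n [set 0%R])) ?ge0_fin_numE//.
set v := fine _; move=> -[] /eqP; rewrite -subr_eq0 -{2}(mul1r v) -mulrBl.
rewrite mulf_eq0 => /orP[|/eqP -> //].
by rewrite subr_eq0 gt_eqF// exprn_egt1 ?ltr1n ?lt0n// -lt0n.
Qed.

Lemma lebesgue_rV_punctured_ball n : (0 < n)%N ->
  lebesgue_rV n (@punctured_unit_ball R n) = lebesgue_rV n (@unit_ball R n).
Proof.
move=> n0.
have -> : @unit_ball R n = punctured_unit_ball `|` [set 0%R].
  apply/seteqP; split => x; rewrite /punctured_unit_ball/unit_ball/=.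
    have [->|x0] := eqVneq x 0%R; first by right.
    by left; rewrite enorm_gt0 x0.
  by move=> [/andP[]//|->]; rewrite enorm0.
have dis : @punctured_unit_ball R n `&` [set 0%R] = set0.
  apply/seteqP; split => // x [] /[swap] -> /=.
  by rewrite /punctured_unit_ball/= enorm0 ltxx.
rewrite (measureU _ (@measurable_punctured_unit_ball R n)
  (@measurable_origin n) dis).
by rewrite [X in _ + X]lebesgue_rV_origin// adde0.
Qed.

(** The uniqueness argument for Haar measure, applied to Lebesgue measure and
    its image under O: for the symmetric ball B, the double integral of
    h(xO + y) 1_B(y) is evaluated by translating x or by translating y, and
    gives vol(B) times either side. *)
Lemma ge0_integral_rV_orthogonal n (O : 'M[R]_n) (h : 'rV[R]_n -> \bar R) :
  O *m O^T = 1%:M -> measurable_fun setT h -> (forall x, 0 <= h x) ->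
  \int[lebesgue_rV n]_x h (x *m O)%R = \int[lebesgue_rV n]_x h x.
Proof.
move=> OO mh h0.
have OtO : O^T *m O = 1%:M by exact: mulmx1C.
pose b (x : 'rV[R]_n) := (\1_unit_ball x)%:E : \bar R.
have b0 x : 0 <= b x by rewrite lee_fin.
have mb : measurable_fun setT b.
  by apply/measurable_EFinP; apply: measurable_indic; exact: measurable_unit_ball.
have bN x : b (- x)%R = b x.
  rewrite /b !indicE; suff -> : (- x \in unit_ball)%R = (x \in unit_ball) by [].
  by apply/idP/idP; rewrite !inE /unit_ball/= enormN.
have Lb : \int[lebesgue_rV n]_x b x = lebesgue_rV n unit_ball.
  by rewrite integral_indic ?setIT//; exact: measurable_unit_ball.
have mhO : measurable_fun setT (fun x => h (x *m O)).
  exact: (measurableT_comp mh (@measurable_mulmxr R n n O)).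
pose F (p : 'rV[R]_n * 'rV[R]_n) := h (p.1 *m O + p.2)%R * b p.2.
have F0 p : 0 <= F p by rewrite mule_ge0.
have mF : measurable_fun setT F.
  apply: emeasurable_funM; last exact: (measurableT_comp mb).
  apply: (measurableT_comp mh).
  apply: measurable_funD_rV => //.
  exact: (measurableT_comp (@measurable_mulmxr R n n O)).
pose G (p : 'rV[R]_n * 'rV[R]_n) := h p.2 * b (p.2 - p.1 *m O)%R.
have G0 p : 0 <= G p by rewrite mule_ge0.
have mG : measurable_fun setT G.
  apply: emeasurable_funM; first exact: (measurableT_comp mh).
  apply: (measurableT_comp mb).
  apply: measurable_funD_rV => //.
  apply: (measurableT_comp (@measurable_opprV R n)).
  exact: (measurableT_comp (@measurable_mulmxr R n n O)).
have E1 : \int[lebesgue_rV n]_y \int[lebesgue_rV n]_x F (x, y) =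
    \int[lebesgue_rV n]_x h (x *m O) * lebesgue_rV n unit_ball.
  rewrite -Lb -ge0_integralZl//; last by apply: integral_ge0.
  apply: eq_integral => y _; rewrite /F/= ge0_integralZr//; last first.
    exact: (measurableT_comp mh (measurableT_comp (measurable_addr_rV y)
      (@measurable_mulmxr R n n O))).
  congr (_ * _); rewrite -[LHS](ge0_integral_rV_shift (- (y *m O^T)))//; last first.
    exact: (measurableT_comp mh (measurableT_comp (measurable_addr_rV y)
      (@measurable_mulmxr R n n O))).
  apply: eq_integral => x _; congr h.
  by rewrite mulmxDl mulNmx -mulmxA OtO mulmx1 subrK.
have E2 : \int[lebesgue_rV n]_x \int[lebesgue_rV n]_y F (x, y) =
    \int[lebesgue_rV n]_x \int[lebesgue_rV n]_y G (x, y).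
  apply: eq_integral => x _; rewrite -[LHS](ge0_integral_rV_shift (- (x *m O)))//.
    by apply: eq_integral => y _; rewrite /F /G/= addrC subrK.
  exact: (measurable_fun_pair2 x mF).
have E3 : \int[lebesgue_rV n]_y \int[lebesgue_rV n]_x G (x, y) =
    \int[lebesgue_rV n]_x h x * lebesgue_rV n unit_ball.
  transitivity (\int[lebesgue_rV n]_y (h y * lebesgue_rV n unit_ball)); last first.
    exact: (ge0_integralZr (lebesgue_rV n) measurableT mh (fun x _ => h0 x) (measure_ge0 _ _)).
  apply: eq_integral => y _.
  have mby : measurable_fun setT (fun x => b (y - x *m O)%R).
    apply: (measurableT_comp mb).
    exact: (measurable_funD_rV (measurable_cst y)
      (measurableT_comp (@measurable_opprV R n) (@measurable_mulmxr R n n O))).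
  transitivity (h y * \int[lebesgue_rV n]_x b (y - x *m O)%R).
    exact: (ge0_integralZl (lebesgue_rV n) measurableT mby (fun x _ => b0 _) (h0 y)).
  congr (_ * _); rewrite -Lb.
  rewrite -(ge0_integral_rV_shift (y *m O^T) mby (fun=> b0 _)).
  apply: eq_integral => x _; rewrite mulmxDl -mulmxA OtO mulmx1 opprD addrCA subrr addr0.
  rewrite bN /b !indicE; suff -> : (x *m O \in unit_ball)%R = (x \in unit_ball) by [].
  by apply/idP/idP; rewrite !inE /unit_ball/= enorm_mulmx.
have B0 := lebesgue_rV_unit_ball_gt0 n.
have Bfin := lebesgue_rV_unit_ball_fin_num n.
have := etrans (etrans (esym E1) (esym (fubini_tonelli (m1 := lebesgue_rV n)
  (m2 := lebesgue_rV n) F mF F0))) (etrans E2 (etrans (fubini_tonelli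
  (m1 := lebesgue_rV n) (m2 := lebesgue_rV n) G mG G0) E3)).
move: (\int[lebesgue_rV n]_x h (x *m O)) (\int[lebesgue_rV n]_x h x) => u v.
exact: (inc_inj (lee_pmul2r Bfin B0)).
Qed.

End ball_volume.

(** * Polar coordinates *)

Section radial_integrals.
Context {R : realType}.
Local Notation leb := (@lebesgue_measure R).
Local Open Scope ereal_scope.

Lemma is_derive_exprn n (x : R) :
  is_derive x 1%R (fun y : R => y ^+ n.+1)%R (n.+1%:R * x ^+ n)%R.
Proof.
have := @is_deriveX R R id n.+1 x 1%R 1%R (is_derive_id _ _).
by rewrite fctE /GRing.scale/= mulr1.
Qed.

Lemma is_derive_exprV n (x : R) : (0 < x)%R ->
  is_derive x 1%R (fun y : R => (- (n.+1%:R)^-1 * (y ^+ n.+1)^-1)%R) ((x ^+ n.+2)^-1)%R.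
Proof.
move=> x0; have xn0 : (x ^+ n.+1 != 0)%R by rewrite expf_neq0// gt_eqF.
have dV := @is_deriveV R (fun y => y ^+ n.+1)%R x _ _ xn0 (is_derive_exprn n x).
rewrite (_ : (x ^+ n.+2)^-1 = - (n.+1%:R)^-1 *:
    (- (x ^+ n.+1) ^- 2 *: (n.+1%:R * x ^+ n)))%R; last first.
  rewrite /GRing.scale/= exprS (exprS x n).
  have k0 : (n.+1%:R != 0 :> R)%R by rewrite pnatr_eq0.
  have X0 : (x ^+ n != 0)%R by rewrite expf_neq0 ?gt_eqF.
  move: (n.+1%:R)%R (x ^+ n)%R k0 X0 => k X k0 X0.
  by field; rewrite k0 X0 gt_eqF.
exact: is_deriveZ dV.
Qed.

(** Multiplied by (n+1) r^(n+1), the integrand becomes a probability density on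
    the radii s >= r; the polar coordinates formula spreads a point at distance
    r from the origin over these radii. *)
Lemma integral_exprV n (r : R) : (0 < r)%R ->
  \int[leb]_(s in `[r, +oo[) ((s ^+ n.+2)^-1)%:E = ((n.+1%:R)^-1 * (r ^+ n.+1)^-1)%:E.
Proof.
move=> r0; have dF x : (r <= x)%R -> is_derive x 1%R
    (fun y : R => (- (n.+1%:R)^-1 * (y ^+ n.+1)^-1)%R) ((x ^+ n.+2)^-1)%R.
  by move=> rx; apply: is_derive_exprV; exact: lt_le_trans rx.
rewrite (@ge0_continuous_FTC2y _ _ (fun y => - (n.+1%:R)^-1 * (y ^+ n.+1)^-1)%R _ 0%R).
- by rewrite sub0e -EFinN mulNr opprK.
- by move=> x rx; rewrite invr_ge0 exprn_ge0// (le_trans (ltW r0)).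
- apply: continuous_in_subspaceT => x; rewrite inE/= in_itv/= andbT => rx.
  apply: cvgV; first by rewrite expf_neq0// gt_eqF// (lt_le_trans r0).
  exact: exprn_continuous.
- rewrite -(mulr0 (- (n.+1%:R)^-1)%R); apply: cvgM; first exact: cvg_cst.
  apply/gtr0_cvgV0.
    by near=> y; rewrite exprn_gt0//; near: y; apply: nbhs_pinfty_gt; exact: num_real.
  apply/cvgryPge => A; near=> y; apply: (@le_trans _ _ y).
    by near: y; apply: nbhs_pinfty_ge; exact: num_real.
  by rewrite exprS ler_peMr ?exprn_ege1//; near: y; apply: nbhs_pinfty_ge; exact: num_real.
- by move=> x rx; have [] := dF x (ltW rx).
- have cF : {for r, continuous (fun y : R => - (n.+1%:R)^-1 * (y ^+ n.+1)^-1)%R}.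
    apply: differentiable_continuous; apply/derivable1_diffP.
    by have [] := dF r (lexx r).
  exact: cvg_at_right_filter cF.
- move=> x; rewrite in_itv/= andbT => rx.
  by have := dF x (ltW rx) => dx; rewrite derive1E; exact: derive_val.
Unshelve. all: by end_near. Qed.

Lemma integral_exprn n (r : R) : (0 <= r)%R ->
  \int[leb]_(t in `[0%R, r]) (t ^+ n)%:E = (r ^+ n.+1 / n.+1%:R)%:E.
Proof.
rewrite le_eqVlt => /predU1P[<-|r0].
  by rewrite set_itv1 integral_set1 expr0n/= mul0r.
have dX (x : R) : is_derive x 1%R (fun y : R => (n.+1%:R)^-1 * y ^+ n.+1)%R (x ^+ n)%R.
  rewrite (_ : x ^+ n = (n.+1%:R)^-1 *: (n.+1%:R * x ^+ n))%R; last first.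
    by rewrite /GRing.scale/= mulrA mulVf ?mul1r// pnatr_eq0.
  exact: (@is_deriveZ _ _ _ _ _ _ _ _ (is_derive_exprn n x)).
rewrite (@continuous_FTC2 _ _ (fun y => (n.+1%:R)^-1 * y ^+ n.+1)%R)//.
- by rewrite expr0n/= mulr0 sube0 mulrC.
- by apply: continuous_subspaceT => x; exact: exprn_continuous.
- have cX (x : R) : {for x, continuous (fun y : R => (n.+1%:R)^-1 * y ^+ n.+1)%R}.
    apply: differentiable_continuous; apply/derivable1_diffP.
    by have [] := dX x.
  split.
  + by move=> x _; have [] := dX x.
  + exact: cvg_at_right_filter (cX 0%R).
  + exact: cvg_at_left_filter (cX r).
- by move=> x _; rewrite derive1E; have := dX x => dx; exact: derive_val.
Qed.

End radial_integrals.

Section polar.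
Context {R : realType}.
Local Notation leb := (@lebesgue_measure R).
Local Open Scope ereal_scope.

Lemma ge0_integral_mrestr d (T : measurableType d) (mu : {measure set T -> \bar R})
    (D : set T) (mD : measurable D) (g : T -> \bar R) :
  measurable_fun setT g -> (forall x, 0 <= g x) ->
  \int[mrestr mu mD]_x g x = \int[mu]_(x in D) g x.
Proof.
move=> mg g0; rewrite -(setUv D) ge0_integral_setU//; last 3 first.
- exact: measurableC.
- by rewrite setUv.
- by apply/disj_set2P; rewrite setICr.
rewrite [X in _ + X](_ : _ = 0) ?adde0.
  by apply: eq_measure_integral => A mA AD; rewrite -[LHS]/(mu (A `&` D)) setIidl.
rewrite -(integral_measure_zero (~` D) g); apply: eq_measure_integral => A mA AD.
by rewrite -[LHS]/(mu (A `&` D)) (_ : A `&` D = set0) ?measure0// -subset0 => x [/AD].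
Qed.

(** The surface measure is n times the image of Lebesgue measure on the punctured
    ball, so Tonelli's theorem in R^n applies to integrals over the sphere. *)
Lemma ge0_integral_sphere n (g : 'rV[R]_n -> \bar R) :
  measurable_fun setT g -> (forall x, 0 <= g x) ->
  \int[@sphere_measure R n]_x g x =
  n%:R%:E * \int[lebesgue_rV n]_(x in punctured_unit_ball) g (radial x).
Proof.
move=> mg g0; have mr := @measurable_radial R n.
have mgr : measurable_fun setT (g \o @radial R n) by exact: measurableT_comp mg mr.
rewrite (@ge0_integral_pushforward _ _ _ _ _ _ mr)// preimage_setT.
rewrite ge0_integral_mscale//; last by move=> x _; exact: g0.
by rewrite ge0_integral_mrestr// => x; exact: g0.
Qed.

(** The radial density of polar coordinates in dimension d, extended by 0 so
    that dilations and Tonelli's theorem apply on the whole line. *)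
Definition radial_weight (d : nat) (t : R) : R :=
  (\1_`]0%R, +oo[ t * t ^+ d.-1)%R.

Lemma radial_weightE d (t : R) : (0 < t)%R -> radial_weight d t = (t ^+ d.-1)%R.
Proof.
by move=> t0; rewrite /radial_weight indicE mem_set ?mul1r//= in_itv/= t0.
Qed.

Lemma radial_weight_le0 d (t : R) : (t <= 0)%R -> radial_weight d t = 0%R.
Proof.
move=> t0; rewrite /radial_weight indicE memNset ?mul0r//= in_itv/= andbT.
by apply/negP; rewrite -leNgt.
Qed.

Lemma radial_weight_ge0 d t : (0 <= radial_weight d t)%R.
Proof.
have [t0|t0] := leP t 0%R; first by rewrite radial_weight_le0.
by rewrite radial_weightE// exprn_ge0// ltW.
Qed.

Lemma radial_weightM d (r t : R) : (0 < r)%R ->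
  radial_weight d (r * t) = (r ^+ d.-1 * radial_weight d t)%R.
Proof.
move=> r0; have [t0|t0] := leP t 0%R.
  by rewrite (radial_weight_le0 _ t0) radial_weight_le0 ?mulr0 ?pmulr_rle0.
by rewrite (radial_weightE _ t0) radial_weightE ?mulr_gt0// exprMn.
Qed.

Lemma mule_radial_weight_ge0 (v : \bar R) d t : 0 <= v ->
  0 <= v * (radial_weight d t)%:E.
Proof. by move=> v0; apply: mule_ge0 => //; rewrite lee_fin radial_weight_ge0. Qed.

Lemma measurable_radial_weight d : measurable_fun setT (radial_weight d).
Proof. by apply: measurable_funM => //; apply: measurable_funX. Qed.

(* The inverse on positive reals, as a function that is measurable on all of R. *)
Let pinv (s : R) : R := (s `^ (-1))%R.
Let pinvE (s : R) : (0 < s)%R -> pinv s = (s^-1)%R.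
Proof. by move=> s0; rewrite /pinv powR_inv1// ltW. Qed.
Let m_pinv : measurable_fun setT pinv.
Proof. exact: measurable_powR. Qed.

(* For s >= |x| > 0 this is n |x|^n s^(-n-1), and it vanishes elsewhere. The
   condition is put on x / s, which becomes y after the dilation x = s y. *)
Let kernel n (p : R * 'rV[R]_n) : R :=
  (\1_`]0%R, +oo[ p.1 * \1_punctured_unit_ball (pinv p.1 *: p.2) *
  (n%:R * enorm p.2 ^+ n * pinv p.1 ^+ n.+1))%R.

Let m_kernel n : measurable_fun setT (@kernel n).
Proof.
have m1 : measurable_fun setT (\1_`]0%R, +oo[ : R -> R) by exact: measurable_indic.
have m2 : measurable_fun setT (\1_punctured_unit_ball : 'rV[R]_n -> R).
  by apply: measurable_indic; exact: measurable_punctured_unit_ball.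
have m3 : measurable_fun setT (fun p : R * 'rV[R]_n => pinv p.1).
  exact: (measurableT_comp m_pinv measurable_fst).
apply: measurable_funM; first apply: measurable_funM.
- exact: (measurableT_comp m1 measurable_fst).
- exact: (measurableT_comp m2 (measurable_funZ_rV m3 measurable_snd)).
- apply: measurable_funM; last exact: measurable_funX.
  apply: measurable_funM => //; apply: measurable_funX.
  exact: (measurableT_comp (@measurable_enorm R n) measurable_snd).
Qed.

Let kernel_ge0 n p : (0 <= @kernel n p)%R.
Proof.
by rewrite /kernel !mulr_ge0// exprn_ge0// ?powR_ge0 ?enorm_ge0.
Qed.

Let kernel_out n (x : 'rV[R]_n) s : (s <= 0)%R -> kernel (s, x) = 0%R.
Proof.
move=> s0; rewrite /kernel/= indicE memNset ?mul0r//= in_itv/= andbT.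
by apply/negP; rewrite -leNgt.
Qed.

Let kernelE n (x : 'rV[R]_n) s : (0 < s)%R ->
  kernel (s, x) = (\1_punctured_unit_ball (s^-1 *: x) *
    (n%:R * enorm x ^+ n * (s ^+ n.+1)^-1))%R.
Proof.
move=> s0; rewrite /kernel/= indicE mem_set ?mul1r ?pinvE ?exprVn//=.
by rewrite in_itv/= s0.
Qed.

Let punctured_scale n (x : 'rV[R]_n) s : x != 0%R -> (0 < s)%R ->
  punctured_unit_ball (s^-1 *: x)%R <-> (enorm x <= s)%R.
Proof.
move=> x0 s0; have x1 : (0 < enorm x)%R by rewrite enorm_gt0.
rewrite /punctured_unit_ball/= enormZ ger0_norm ?invr_ge0 ?(ltW s0)//.
by rewrite pmulr_rgt0 ?invr_gt0// x1/= mulrC ler_pdivrMr// mul1r.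
Qed.

Let integral_kernel n (x : 'rV[R]_n) : (0 < n)%N -> x != 0%R ->
  \int[leb]_s (kernel (s, x))%:E = 1.
Proof.
move=> n0 x0; have x1 : (0 < enorm x)%R by rewrite enorm_gt0.
transitivity (\int[leb]_s ((fun s : R => (n%:R * enorm x ^+ n)%:E *
    ((s ^+ n.+1)^-1)%:E) \_ `[enorm x, +oo[) s).
  apply: eq_integral => s _; have [s0|s0] := leP s 0%R.
    rewrite kernel_out// patchE memNset//= in_itv/= andbT => xs.
    by move: x1; rewrite ltNge (le_trans xs).
  rewrite kernelE// patchE indicE.
  have [xs|xs] := leP (enorm x) s.
    rewrite mem_set; last exact/punctured_scale.
    by rewrite mem_set ?mul1r// /= in_itv/= xs.
  rewrite memNset; last by move/(punctured_scale x0 s0); rewrite leNgt xs.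
  by rewrite memNset ?mul0r// /= in_itv/= andbT leNgt xs.
rewrite -integral_mkcond ge0_integralZl//.
- move: (enorm x) x1 => r r0.
  rewrite -(prednK n0) integral_exprV// -EFinM; congr EFin.
  have k0 : (n.-1.+1%:R != 0 :> R)%R by rewrite pnatr_eq0.
  have X0 : (r ^+ n.-1.+1 != 0)%R by rewrite expf_neq0 ?gt_eqF.
  move: (n.-1.+1%:R)%R (r ^+ _)%R k0 X0 => k X k0 X0.
  by field; rewrite k0 X0.
- apply/measurable_EFinP; apply: (eq_measurable_fun (fun s => (pinv s) ^+ n.+1)%R).
    move=> s; rewrite inE/= in_itv/= andbT => xs.
    by rewrite pinvE ?exprVn// (lt_le_trans x1).
  by apply: measurable_funX; exact: measurable_funTS.
- move=> s /=; rewrite in_itv/= andbT => xs.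
  by rewrite lee_fin invr_ge0 exprn_ge0// (le_trans (ltW x1)).
- by rewrite lee_fin mulr_ge0// exprn_ge0// enorm_ge0.
Qed.

Lemma measurable_radial_integrand n d (h : 'rV[R]_n -> \bar R) : measurable_fun setT h ->
  measurable_fun setT (fun p : 'rV[R]_n * measurableTypeR R =>
    h (p.2 *: p.1)%R * (radial_weight d p.2)%:E).
Proof.
move=> mh; apply: emeasurable_funM.
  exact: (measurableT_comp mh (measurable_funZ_rV measurable_snd measurable_fst)).
apply/measurable_EFinP.
exact: (measurableT_comp (measurable_radial_weight d) measurable_snd).
Qed.

Lemma measurable_radial_integral n d (h : 'rV[R]_n -> \bar R) :
  measurable_fun setT h -> (forall x, 0 <= h x) ->
  measurable_fun setT (fun x : 'rV[R]_n =>
    \int[leb]_t (h (t *: x)%R * (radial_weight d t)%:E)).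
Proof.
move=> mh h0; apply: (measurable_fun_fubini_tonelli_F (m2 := leb) _
  (measurable_radial_integrand d mh)).
by move=> p; exact: mule_radial_weight_ge0.
Qed.

(** Each point x is spread over the radii s >= |x|; for fixed s the dilation
    x = s y brings it back to the unit ball, and for fixed y the dilation
    s = t / |y| turns s y into t times a unit vector. *)
Lemma polar_coordinates n (h : 'rV[R]_n -> \bar R) : (0 < n)%N ->
  measurable_fun setT h -> (forall x, 0 <= h x) ->
  \int[lebesgue_rV n]_x h x =
  \int[@sphere_measure R n]_x \int[leb]_t (h (t *: x)%R * (radial_weight n t)%:E).
Proof.
move=> n0 mh h0.
pose D (p : measurableTypeR R * 'rV[R]_n) := h p.2 * (kernel p)%:E.
have D0 p : 0 <= D p by rewrite mule_ge0// lee_fin kernel_ge0.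
have mD : measurable_fun setT D.
  apply: emeasurable_funM; first exact: (measurableT_comp mh measurable_snd).
  by apply/measurable_EFinP; exact: (@m_kernel n).
pose P (p : measurableTypeR R * 'rV[R]_n) := h (p.1 *: p.2)%R *
  (radial_weight n p.1 * (\1_punctured_unit_ball p.2 * (n%:R * enorm p.2 ^+ n)))%:E.
have P0 p : 0 <= P p.
  apply: mule_ge0 => //; rewrite lee_fin mulr_ge0 ?radial_weight_ge0//.
  by rewrite mulr_ge0// mulr_ge0// exprn_ge0// enorm_ge0.
have mP : measurable_fun setT P.
  apply: emeasurable_funM.
    exact: (measurableT_comp mh (measurable_funZ_rV measurable_fst measurable_snd)).
  apply/measurable_EFinP; apply: measurable_funM.
    exact: (measurableT_comp (measurable_radial_weight n) measurable_fst).
  have m2 : measurable_fun setT (fun x : 'rV[R]_n =>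
      (\1_punctured_unit_ball x * (n%:R * enorm x ^+ n))%R).
    apply: measurable_funM.
      by apply: measurable_indic; exact: measurable_punctured_unit_ball.
    by apply: measurable_funM => //; apply: measurable_funX; exact: measurable_enorm.
  exact: (measurableT_comp m2 measurable_snd).
have E1 : \int[lebesgue_rV n]_x h x = \int[lebesgue_rV n]_x \int[leb]_s D (s, x).
  apply: ge0_ae_eq_integral => //.
  - exact: (measurable_fun_fubini_tonelli_G (m1 := leb) D mD D0).
  - by move=> x _; apply: integral_ge0.
  exists [set 0%R]; split.
  - exact: measurable_origin.
  - exact: lebesgue_rV_origin.
  - move=> x /= xh; apply/eqP/negPn/negP => x0; apply: xh => _.
    transitivity (h x * \int[leb]_s (kernel (s, x))%:E).
      by rewrite integral_kernel// mule1.
    have mk : measurable_fun setT (fun s : measurableTypeR R => (kernel (s, x))%:E).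
      by apply/measurable_EFinP; exact: (measurable_fun_pair1 x (@m_kernel n)).
    have k0 (s : measurableTypeR R) : setT s -> 0 <= (kernel (s, x))%:E.
      by move=> _; rewrite lee_fin kernel_ge0.
    exact: (esym (ge0_integralZl leb measurableT mk k0 (h0 x))).
have E2 := fubini_tonelli (m1 := leb) (m2 := lebesgue_rV n) D mD D0.
have E3 : \int[leb]_s \int[lebesgue_rV n]_x D (s, x) =
    \int[leb]_s \int[lebesgue_rV n]_x P (s, x).
  apply: eq_integral => s _; have [s0|s0] := leP s 0%R.
    apply: eq_integral => x _; rewrite /D /P/= kernel_out// mule0.
    by rewrite radial_weight_le0// mul0r mule0.
  have mDs : measurable_fun setT (fun x => D (s, x)).
    exact: (measurable_fun_pair2 s mD).
  rewrite -(ge0_integral_rV_scale s0 mDs (fun=> D0 _)).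
  transitivity (\int[lebesgue_rV n]_x ((s ^+ n)%:E * D (s, s *: x)%R)).
    have mDss := measurableT_comp mDs (@measurable_scale_rV R n s).
    have sn0 : 0 <= (s ^+ n)%:E by rewrite lee_fin exprn_ge0// ltW.
    exact: (esym (ge0_integralZl (lebesgue_rV n) measurableT mDss (fun _ _ => D0 _) sn0)).
  apply: eq_integral => x _; rewrite /D /P/= muleCA -EFinM; congr (_ * _%:E).
  rewrite kernelE// scalerA mulVf ?gt_eqF// scale1r enormZ gtr0_norm//.
  rewrite radial_weightE//.
  have sE : (s ^+ n = s * s ^+ n.-1)%R by rewrite -exprS prednK.
  have S0 : (s ^+ n.-1 != 0)%R by rewrite expf_neq0 ?gt_eqF.
  rewrite exprMn exprS sE.
  move: (\1_punctured_unit_ball x) (s ^+ n.-1)%R S0 => B S S0.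
  by field; rewrite S0 gt_eqF.
have E4 := fubini_tonelli (m1 := leb) (m2 := lebesgue_rV n) P mP P0.
pose g (x : 'rV[R]_n) := \int[leb]_t (h (t *: x)%R * (radial_weight n t)%:E).
have g0 x : 0 <= g x.
  by apply: integral_ge0 => t _; exact: (mule_radial_weight_ge0 _ _ (h0 _)).
have mg : measurable_fun setT g by exact: measurable_radial_integral.
have E5 : \int[lebesgue_rV n]_x \int[leb]_s P (s, x) =
    \int[lebesgue_rV n]_x ((fun x => n%:R%:E * g (radial x)) \_ punctured_unit_ball) x.
  apply: eq_integral => x _; rewrite patchE; case: ifPn => xB; last first.
    apply: integral0_eq => s _; rewrite /P/= indicE (negbTE xB).
    by rewrite mul0r mulr0 mule0.
  have x0 : (0 < enorm x)%R by move: xB; rewrite inE => -/andP[].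
  have r0 : (0 < (enorm x)^-1)%R by rewrite invr_gt0.
  have mPx : measurable_fun setT (fun s => P (s, x)).
    exact: (measurable_fun_pair1 x mP).
  rewrite -(ge0_integral_scale r0 mPx (fun=> P0 _)).
  transitivity (\int[leb]_t ((enorm x)^-1%:E * P ((enorm x)^-1 * t, x)%R)).
    have mPr : measurable_fun setT
        (fun t : measurableTypeR R => P ((enorm x)^-1 * t, x)%R).
      have mr : measurable_fun setT (fun t : measurableTypeR R =>
          ((enorm x)^-1 * t)%R : measurableTypeR R) by exact: measurable_funM.
      exact: (measurableT_comp mPx mr).
    have r0' : 0 <= (enorm x)^-1%:E by rewrite lee_fin ltW.
    exact: (esym (ge0_integralZl leb measurableT mPr (fun _ _ => P0 _) r0')).
  transitivity (\int[leb]_t (n%:R%:E * (h (t *: radial x)%R * (radial_weight n t)%:E))).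
    apply: eq_integral => t _; rewrite /P/= /radial scalerA (mulrC t).
    rewrite muleCA [RHS]muleCA -!EFinM; congr (_ * _%:E).
    rewrite (radial_weightM _ _ r0) indicE xB mul1r exprVn.
    move: (radial_weight n t) => w.
    have eE : (enorm x ^+ n = enorm x * enorm x ^+ n.-1)%R by rewrite -exprS prednK.
    rewrite eE.
    have X0 : (enorm x ^+ n.-1 != 0)%R by rewrite expf_neq0 ?gt_eqF.
    by field; rewrite X0 gt_eqF.
  have w0 (t : measurableTypeR R) : setT t ->
      0 <= h (t *: radial x)%R * (radial_weight n t)%:E.
    by move=> _; exact: (mule_radial_weight_ge0 _ _ (h0 _)).
  have mw := measurable_fun_pair2 (radial x) (measurable_radial_integrand n mh).
  exact: (ge0_integralZl leb measurableT mw w0 (ler0n _ n : 0 <= n%:R%:E)).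
have E6 : \int[lebesgue_rV n]_x h x =
    \int[lebesgue_rV n]_(x in punctured_unit_ball) (n%:R%:E * g (radial x)).
  rewrite [RHS]integral_mkcond.
  exact: (etrans E1 (etrans (esym E2) (etrans E3 (etrans E4 E5)))).
have mgr : measurable_fun punctured_unit_ball (g \o @radial R n).
  by apply: measurable_funTS; exact: (measurableT_comp mg (@measurable_radial R n)).
have E7 := ge0_integralZl (lebesgue_rV n) (@measurable_punctured_unit_ball R n) mgr
  (fun _ _ => g0 _) (ler0n _ n : 0 <= n%:R%:E).
exact: (etrans E6 (etrans E7 (esym (ge0_integral_sphere mg g0)))).
Qed.

End polar.

(** * Star bodies and their Minkowski functional *)

Section star_bodies.
Context {R : realType} {n : nat}.
Variable K : set 'rV[R]_n.
Hypothesis K_star : star_body K.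

Let K_closed : closed K. Proof. by have [[]] := K_star. Qed.
Let K0 : K° 0. Proof. by have [_ _] := K_star. Qed.

Let K_00 : K 0. Proof. exact: interior_subset K0. Qed.

(* With the witness c, the norm of c x exceeds the bound |M| + 1 on K. *)
Let K_outside (x : 'rV[R]_n) a : x != 0 -> exists2 b, a < b & ~ K (b *: x).
Proof.
move=> x0; have [[_ [M [_ KM]]] _ _ _] := K_star.
have x1 : 0 < `|x| by rewrite normr_gt0.
pose c := Num.max 0 a + 1 + (`|M| + 2) / `|x|.
have c0 : 0 < c.
  by rewrite addr_gt0 ?divr_gt0 ?ltr_wpDl// le_max lexx.
exists c.
  rewrite /c -addrA (le_lt_trans (_ : _ <= Num.max 0 a))//.
    by rewrite le_max lexx orbT.
  by rewrite ltrDl addr_gt0// divr_gt0// ltr_wpDl.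
move=> /(KM (`|M| + 1)); rewrite (le_lt_trans (ler_norm M)) ?ltrDl//.
move=> /(_ erefl); apply/negP; rewrite -ltNge normrZ gtr0_norm//.
rewrite /c mulrDl divfK ?gt_eqF// ltr_wpDl//.
  by rewrite mulr_ge0// addr_ge0// le_max lexx.
by rewrite ltrD2l ltr1n.
Qed.

Let continuous_ray (x : 'rV[R]_n) : continuous (fun t : R => t *: x).
Proof. by move=> t; apply: cvgZr_tmp; exact: cvg_id. Qed.

(** Between a point of K and a point outside K on the same ray there is a
    boundary point: the last point before the ray leaves K. *)
Let crossing (x : 'rV[R]_n) a b : a < b -> K (a *: x) -> ~ K (b *: x) ->
  exists t, [/\ a <= t, t < b & boundary K (t *: x)].
Proof.
move=> ab Ka Kb; pose A := [set t | a <= t <= b /\ K (t *: x)].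
have A0 : A !=set0 by exists a; rewrite /A/= lexx ltW.
have Aub : has_sup A by split => //; exists b => t [/andP[]].
have cA : closed A.
  rewrite (_ : A = `[a, b] `&` (fun t => t *: x) @^-1` K).
    apply: closedI; first exact: itv_closed.
    exact: (continuous_closedP _).1 (@continuous_ray x) _ K_closed.
  by apply/seteqP; split => t; rewrite /A/= in_itv.
have [/andP[at_ tb] Kt] : A (sup A) by apply: cA; exact: closure_sup A0 Aub.2.
have tltb : sup A < b.
  by rewrite lt_neqAle tb andbT; apply/eqP => tE; apply: Kb; rewrite -tE.
exists (sup A); split => //; split; first exact: subset_closure.
move=> /(@continuous_ray x)/nbhs_ballP[e /= e0 eK].
have [d d0 [de db]] : exists2 d, 0 < d & d < e /\ sup A + d <= b.
  exists (Num.min (e / 2) (b - sup A)).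
    by rewrite lt_min divr_gt0//= subr_gt0.
  split; first by rewrite gt_min ltr_pdivrMr// ltr_pMr// ltr1n.
  by rewrite -lerBrDl ge_min lexx orbT.
have : A (sup A + d).
  split; first by rewrite db andbT (le_trans at_)// lerDl ltW.
  apply: (eK (sup A + d)).
  by rewrite /ball/= opprD addrA subrr sub0r normrN gtr0_norm.
move=> /(ub_le_sup Aub.2); rewrite leNgt ltrDl => /negP; exact.
Qed.

Let ray_exit (x : 'rV[R]_n) : x != 0 ->
  exists2 t, 0 < t & boundary K (t *: x).
Proof.
move=> x0; have [b b0 Kb] := K_outside 0 x0.
have K0x : K (0 *: x) by rewrite scale0r.
have [t [t0 tb bt]] := crossing b0 K0x Kb.
exists t => //; rewrite lt_neqAle t0 andbT; apply/eqP => t0E.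
by move: bt; rewrite -t0E scale0r => -[_]; exact.
Qed.

(** The boundary has two points on the line, and one of them lies on the opposite
    ray. *)
Let ray_exit_unique (x : 'rV[R]_n) s t : x != 0 -> 0 < s -> 0 < t ->
  boundary K (s *: x) -> boundary K (t *: x) -> s = t.
Proof.
move=> x0 s0 t0 bs bt.
have [r r0 br] : exists2 r, r < 0 & boundary K (r *: x).
  have [|r r0 br] := @ray_exit (- x); first by rewrite oppr_eq0.
  exists (- r); first by rewrite oppr_lt0.
  by rewrite scaleNr -scalerN.
have [_ /(_ x x0)[p [q [_ pq]]] _ _] := K_star.
have mem a : a != 0 -> boundary K (a *: x) -> [set p; q] (a *: x).
  move=> a0 ba; rewrite -pq; split; first by rewrite scaler_eq0 negb_or a0.
  by split => //; exists a.
have inj a b : a *: x = b *: x -> a = b.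
  move=> /eqP; rewrite -subr_eq0 -scalerBl scaler_eq0 (negbTE x0) orbF.
  by rewrite subr_eq0 => /eqP.
have sr : s <> r by move=> sr; move: s0; rewrite sr ltNge ltW.
have tr : t <> r by move=> tr; move: t0; rewrite tr ltNge ltW.
have := mem r (negbT (lt_eqF r0)) br.
have := mem t (negbT (gt_eqF t0)) bt.
have := mem s (negbT (gt_eqF s0)) bs.
case=> es; case=> et.
- by move=> _; exact: inj (etrans es (esym et)).
- by case=> er; [case: sr; exact: inj (etrans es (esym er))|
                 case: tr; exact: inj (etrans et (esym er))].
- by case=> er; [case: tr; exact: inj (etrans et (esym er))|
                 case: sr; exact: inj (etrans es (esym er))].
- by move=> _; exact: inj (etrans es (esym et)).
Qed.

(** Leaving K and coming back would give a ray two boundary points. *)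
Let ray_segment (x : 'rV[R]_n) : x != 0 ->
  exists2 T, 0 < T & forall t, 0 < t -> K (t *: x) <-> t <= T.
Proof.
move=> x0; have [T T0 bT] := ray_exit x0; exists T => // t t0; split.
  move=> Kt; rewrite leNgt; apply/negP => Tt.
  have [b tb Kb] := K_outside t x0.
  have [s [ts _ bs]] := crossing tb Kt Kb.
  have := ray_exit_unique x0 T0 (lt_le_trans t0 ts) bT bs.
  by move=> Ts; move: Tt; rewrite Ts ltNge ts.
rewrite le_eqVlt => /predU1P[->|tT].
  by have [+ _] := bT; exact: K_closed.
apply: contrapT => Kt.
have K0x : K (0 *: x) by rewrite scale0r.
have [s [s0 st bs]] := crossing t0 K0x Kt.
have s1 : 0 < s.
  rewrite lt_neqAle s0 andbT; apply/eqP => s0E.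
  by move: bs; rewrite -s0E scale0r => -[_]; exact.
have := ray_exit_unique x0 s1 T0 bs bT => sT.
by move: (lt_trans st tT); rewrite sT ltxx.
Qed.

Lemma minkowskiP (x : 'rV[R]_n) : x != 0 -> 0 < minkowski_functional K x /\
  forall t, 0 < t -> K (t *: x) <-> t <= (minkowski_functional K x)^-1.
Proof.
move=> x0; have [T T0 KT] := ray_segment x0.
suff -> : minkowski_functional K x = T^-1 by rewrite invr_gt0 invrK.
rewrite /minkowski_functional (_ : mkset _ = `[T^-1, +oo[%classic).
  by rewrite inf_itv.
apply/seteqP; split => a /=; rewrite in_itv/= andbT.
  move=> [a0 [y Ky xy]].
  have {}a0 : 0 < a.
    rewrite lt_neqAle a0 andbT; apply/eqP => a0E.
    by move: x0; rewrite xy -a0E scale0r eqxx.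
  rewrite -[a]invrK lef_pV2 ?posrE ?invr_gt0//; apply/KT; rewrite ?invr_gt0//.
  by rewrite xy scalerA mulVf ?scale1r// gt_eqF.
move=> Ta; have a0 : 0 < a by rewrite (lt_le_trans _ Ta)// invr_gt0.
split; first exact: ltW.
exists (a^-1 *: x); last by rewrite scalerA mulfV ?scale1r// gt_eqF.
by apply/KT; rewrite ?invr_gt0// -[T]invrK lef_pV2 ?posrE ?invr_gt0.
Qed.

End star_bodies.

(** * Continuity of integrals depending on a parameter *)

Section parametric_integrals.
Context {R : realType}.

(** The tube lemma turns joint continuity along a compact set into continuity
    that is uniform in the second variable. *)
Lemma near_uniformly (X Y : topologicalType) (D : set Y) (phi : X -> Y -> R) (p : X) :
  compact D -> (forall y, D y -> {for (p, y), continuous (fun z => phi z.1 z.2)}) ->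
  forall e, 0 < e ->
  \forall x \near p, forall y, D y -> `|phi x y - phi p y| <= e.
Proof.
move=> cD cphi e e0.
have := (@compact_near_coveringP Y D).1 cD X (nbhs p)
  (fun x y => `|phi x y - phi p y| <= e) _.
apply => y Dy; have e20 : 0 < e / 2 by rewrite divr_gt0.
have /cvgrPdist_le/(_ _ e20) := cphi y Dy.
move=> [[A B]/= [pA yB] AB].
exists (B, A) => // -[y' x] /= [By' Ax].
have h1 := AB (x, y') (conj Ax By').
have h2 := AB (p, y') (conj (nbhs_singleton pA) By').
rewrite -(subrK (phi p y) (phi x y')) -addrA (splitr e).
by rewrite (le_trans (ler_normD _ _))// lerD// distrC.
Qed.

Lemma Rintegral_cst d (T : measurableType d) (mu : {measure set T -> \bar R})
    (D : set T) (e : R) : measurable D -> mu D \is a fin_num ->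
  \int[mu]_(t in D) e = e * fine (mu D).
Proof. by move=> mD fD; rewrite /Rintegral integral_cst// fineM. Qed.

Lemma continuous_Rintegral (X : topologicalType) d (T : measurableType d)
    (mu : {measure set T -> \bar R}) (D : set T) (phi : X -> T -> R) (p : X) :
  measurable D -> (mu D < +oo)%E ->
  (\forall x \near p, mu.-integrable D (EFin \o phi x)) ->
  (forall e, 0 < e -> \forall x \near p, forall t, D t -> `|phi x t - phi p t| <= e) ->
  {for p, continuous (fun x => \int[mu]_(t in D) phi x t)}.
Proof.
move=> mD fD iphi cphi; apply/cvgrPdist_le => e e0.
have fD' : mu D \is a fin_num by rewrite ge0_fin_numE.
have m0 : 0 < fine (mu D) + 1 by rewrite ltr_wpDl// fine_ge0.
(* the measure of D may vanish, whence + 1 *)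
have e'0 : 0 < e / (fine (mu D) + 1) by rewrite divr_gt0.
have ip := nbhs_singleton iphi.
have := cphi _ e'0; apply: filterS2 iphi => x ix hx.
rewrite distrC -RintegralB//.
have iB : mu.-integrable D (EFin \o (fun t => phi x t - phi p t)).
  by rewrite (_ : _ \o _ = (EFin \o phi x) \- (EFin \o phi p))%E//; exact: integrableB.
apply: (le_trans (le_normr_Rintegral mD iB)).
apply: (@le_trans _ _ (\int[mu]_(t in D) (e / (fine (mu D) + 1)))).
  apply: le_Rintegral => //.
    rewrite (_ : _ \o _ = abse \o (EFin \o (fun t => phi x t - phi p t)))//.
    exact: integrable_abse.
  apply: measurable_bounded_integrable => //.
  by exists `|e / (fine (mu D) + 1)|; split; [exact: num_real|move=> M /ltW eM t _].
rewrite Rintegral_cst// -mulrA ler_piMr ?(ltW e0)// mulrC ler_pdivrMr// mul1r.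
by rewrite lerDl.
Qed.

End parametric_integrals.

Section segment_integral.
Context {R : realType}.
Local Notation leb := (@lebesgue_measure R).

(** The integral of f over the segment from 0 to p, with the weight of polar
    coordinates in dimension d. The fixed domain [0, 1] reduces continuity in p
    to the tube lemma. *)
Definition segment_integral n (d : nat) (f : 'rV[R]_n -> R) (p : 'rV[R]_n) : R :=
  \int[leb]_(s in `[0, 1]) (f (s *: p) * s ^+ d.-1).

Variables (n : nat) (f : 'rV[R]_n -> R).
Hypothesis f_continuous : continuous f.

Lemma continuous_scale_pair :
  continuous (fun z : 'rV[R]_n * R => z.2 *: z.1).
Proof. by move=> z; apply: cvgZ; [exact: cvg_snd|exact: cvg_fst]. Qed.

Let integrand_continuous d :
  continuous (fun z : 'rV[R]_n * R => f (z.2 *: z.1) * z.2 ^+ d.-1).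
Proof.
move=> z; apply: cvgM.
  exact: (continuous_comp (@continuous_scale_pair z) (@f_continuous _)).
apply: (@continuous_comp _ _ _ (@snd 'rV[R]_n R) (fun s : R => s ^+ d.-1) z).
  exact: cvg_snd.
exact: exprn_continuous.
Qed.

Lemma segment_integrable d p :
  leb.-integrable `[0, 1] (EFin \o (fun s => f (s *: p) * s ^+ d.-1)).
Proof.
apply: continuous_compact_integrable; first exact: segment_compact.
apply: continuous_subspaceT => s.
apply: (@continuous_comp _ _ _ (fun s : R => (p, s))
  (fun z : 'rV[R]_n * R => f (z.2 *: z.1) * z.2 ^+ d.-1) s).
  apply: (@cvg_pair _ _ _ _ (nbhs p) (nbhs s)); [exact: cvg_cst|exact: cvg_id].
exact: integrand_continuous.
Qed.

Lemma segment_integral_continuous d : continuous (segment_integral d f).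
Proof.
have I_fin : (leb `[0%R, 1%R]%classic < +oo)%E.
  by rewrite lebesgue_measure_itv/= lte_fin ltr01 -EFinB ltry.
move=> p; apply: continuous_Rintegral => //.
- by near=> x; exact: segment_integrable.
- apply: near_uniformly; first exact: segment_compact.
  by move=> s _; exact: integrand_continuous.
Unshelve. all: by end_near. Qed.

Hypothesis f_ge0 : forall x, 0 <= f x.

Lemma segment_integral_ge0 d p : 0 <= segment_integral d f p.
Proof.
apply: Rintegral_ge0 => s /=; rewrite in_itv/= => /andP[s0 _].
by rewrite mulr_ge0// exprn_ge0.
Qed.

Lemma segment_integral_le d e p : (d <= e)%N ->
  segment_integral e f p <= segment_integral d f p.
Proof.
move=> de; apply: le_Rintegral => //; try exact: segment_integrable.
move=> s /=; rewrite in_itv/= => /andP[s0 s1]; rewrite ler_wpM2l//.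
by rewrite ler_wiXn2l// -!subn1 leq_sub2r.
Qed.

End segment_integral.

(** * Star bodies in polar coordinates *)

Section star_body_polar.
Context {R : realType} {n : nat}.
Local Notation leb := (@lebesgue_measure R).
Variables (K : set 'rV[R]_n) (f : 'rV[R]_n -> R).
Hypothesis K_star : star_body K.
Hypothesis f_continuous : continuous f.
Hypothesis f_ge0 : forall x, 0 <= f x.

(** The length of the ray of K in the direction x when x is a unit vector. *)
Definition radial_function (x : 'rV[R]_n) : R := (minkowski_functional K x)^-1.

Lemma radial_function_gt0 x : x != 0 -> 0 < radial_function x.
Proof. by move=> /(minkowskiP K_star)[? _]; rewrite invr_gt0. Qed.

Lemma star_bodyP x t : x != 0 -> 0 < t -> K (t *: x) <-> t <= radial_function x.
Proof. by move=> /(minkowskiP K_star)[_]; apply. Qed.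

Lemma radial_function_continuous x : x != 0 -> {for x, continuous radial_function}.
Proof.
move=> x0; have [/lt0r_neq0 m0 _] := minkowskiP K_star x0.
have [_ _ _ mc] := K_star; exact: cvgV m0 (mc x).
Qed.

Lemma measurable_star_body : measurable K.
Proof. by apply: closed_measurable_rV; have [[]] := K_star. Qed.

Definition density_on (x : 'rV[R]_n) : \bar R := (f x * \1_K x)%:E.

Lemma density_on_ge0 x : (0 <= density_on x)%E.
Proof. by rewrite lee_fin mulr_ge0. Qed.

Lemma measurable_density_on : measurable_fun setT density_on.
Proof.
apply/measurable_EFinP; apply: measurable_funM.
  exact: continuous_measurable_rV.
exact: measurable_indic measurable_star_body.
Qed.

(** The integral of t^(d-1) f(t x) over 0 <= t <= rho(x), after the dilation
    t = rho(x) s (see ray_integralE). *)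
Definition ray_integral (d : nat) (x : 'rV[R]_n) : R :=
  radial_function x ^+ d * segment_integral d f (radial_function x *: x).

Lemma ray_integral_ge0 d x : x != 0 -> 0 <= ray_integral d x.
Proof.
move=> x0; rewrite mulr_ge0 ?segment_integral_ge0//.
by rewrite exprn_ge0// ltW// radial_function_gt0.
Qed.

Lemma ray_integral_continuous d x : x != 0 -> {for x, continuous (ray_integral d)}.
Proof.
move=> x0; have rc := radial_function_continuous x0.
have h1 : {for x, continuous (fun y => radial_function y ^+ d)}.
  by apply: (@continuous_comp _ _ _ radial_function (fun s : R => s ^+ d) x);
    [exact: rc|exact: exprn_continuous].
have h2 : {for x, continuous (fun y => segment_integral d f (radial_function y *: y))}.
  apply: (@continuous_comp _ _ _ (fun y => radial_function y *: y)
    (segment_integral d f) x); last exact: segment_integral_continuous.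
  exact: (@cvgZ _ _ _ (nbhs x) _ _ _ _ _ rc cvg_id).
exact: cvgM h1 h2.
Qed.

Lemma ray_integralE d x : (0 < d)%N -> x != 0 ->
  (\int[leb]_t (density_on (t *: x)%R * (radial_weight d t)%:E))%E =
  (ray_integral d x)%:E.
Proof.
move=> d0 x0; have r0 := radial_function_gt0 x0; set r := radial_function x in r0 *.
pose w (t : measurableTypeR R) := (density_on (t *: x)%R * (radial_weight d t)%:E)%E.
have mw : measurable_fun setT w.
  exact: (measurable_fun_pair2 x (measurable_radial_integrand d measurable_density_on)).
have w0 t : (0 <= w t)%E by exact: mule_radial_weight_ge0 (density_on_ge0 _).
rewrite -(ge0_integral_scale r0 mw w0).
pose j (s : measurableTypeR R) := f (s *: (r *: x)) * s ^+ d.-1.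
transitivity (r%:E *
    \int[leb]_s (((fun s => (r ^+ d.-1)%:E * (j s)%:E) \_ `]0%R, 1%R]) s))%E.
  congr (_ * _)%E; apply: eq_integral => s _; rewrite /w patchE.
  rewrite (radial_weightM _ _ r0) /density_on.
  have [s0|s0] := leP s 0.
    rewrite (radial_weight_le0 _ s0) mulr0 mule0 memNset//= in_itv/=.
    by move=> /andP[]; rewrite ltNge s0.
  rewrite (radial_weightE _ s0) indicE.
  have Ks := star_bodyP x0 (mulr_gt0 r0 s0).
  have -> : ((r * s)%R *: x \in K) = (s <= 1).
    apply/idP/idP; first by move=> /set_mem/Ks; rewrite ger_pMr.
    by move=> s1; apply/mem_set/Ks; rewrite ger_pMr.
  have -> : (s \in `]0%R, 1%R]%classic) = (s <= 1).
    by apply/idP/idP; rewrite inE/= in_itv/= s0.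
  case: (s <= 1); last by rewrite mulr0 mul0e.
  by rewrite mulr1 -!EFinM /j scalerA (mulrC s r) mulrCA.
rewrite -integral_mkcond integral_itv_obnd_cbnd; last first.
  have mj := measurable_int _ (segment_integrable f_continuous d (r *: x)).
  apply: measurable_funeM; apply: measurable_funS mj => //.
  by move=> s /=; rewrite !in_itv/= => /andP[/ltW -> ->].
rewrite integralZl//; last exact: segment_integrable.
rewrite muleA -EFinM -exprS prednK// /ray_integral -/r EFinM; congr (_ * _)%E.
rewrite /segment_integral /Rintegral fineK//.
apply: integrable_fin_num => //; exact: segment_integrable.
Qed.

End star_body_polar.

(** * Central sections *)

Section frames.
Context {R : realType} {n : nat}.

Lemma frame_sub d m (F : 'M[R]_(d, n)) (E : 'M[R]_(m, n)) :
  range (fun u : 'rV[R]_d => u *m F) `<=` range (fun u : 'rV[R]_m => u *m E) ->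
  (F <= E)%MS.
Proof.
move=> FE; apply/row_subP => i; rewrite rowE.
by have [|u _ <-] := FE (delta_mx 0 i *m F); [exists (delta_mx 0 i)|exact: submxMl].
Qed.

Lemma orthonormal_rank d (F : 'M[R]_(d, n)) : F *m F^T = 1%:M -> \rank F = d.
Proof.
by move=> FF; apply/eqP; apply/row_freeP; exists F^T.
Qed.

Lemma orthonormal_projection d m (F : 'M[R]_(d, n)) (E : 'M[R]_(m, n)) :
  F *m F^T = 1%:M -> (E <= F)%MS -> E *m F^T *m F = E.
Proof.
by move=> FF /submxP[A ->]; rewrite -!mulmxA (mulmxA F) FF mul1mx.
Qed.

(** Two orthonormal frames of a subspace differ by an orthogonal matrix. *)
Lemma ge0_integral_frame d m (F : 'M[R]_(d, n)) (E : 'M[R]_(m, n))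
    (h : 'rV[R]_n -> \bar R) :
  F *m F^T = 1%:M -> E *m E^T = 1%:M ->
  range (fun u : 'rV[R]_d => u *m F) = range (fun u : 'rV[R]_m => u *m E) ->
  measurable_fun setT h -> (forall x, (0 <= h x)%E) ->
  (\int[lebesgue_rV d]_u h (u *m F) = \int[lebesgue_rV m]_u h (u *m E))%E.
Proof.
move=> FF EE FE mh h0.
have sFE : (F <= E)%MS by apply: frame_sub; rewrite FE.
have sEF : (E <= F)%MS by apply: frame_sub; rewrite FE.
have dm : d = m.
  apply/eqP; rewrite eqn_leq -(orthonormal_rank FF) -(orthonormal_rank EE).
  by rewrite !mxrankS.
move: F FF FE sFE sEF; rewrite {d}dm => F FF FE sFE sEF.
have E_OF := orthonormal_projection FF sEF.
have OO : (E *m F^T) *m (E *m F^T)^T = 1%:M.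
  by rewrite trmx_mul trmxK mulmxA E_OF EE.
have mhF : measurable_fun setT (fun u => h (u *m F)).
  exact: (measurableT_comp mh (@measurable_mulmxr R n m F)).
rewrite -(ge0_integral_rV_orthogonal OO mhF (fun=> h0 _)).
by apply: eq_integral => u _; rewrite -{2}E_OF !mulmxA.
Qed.

Lemma measurable_subspace (H : {vspace 'rV[R]_n}) : measurable [set` H].
Proof.
have [FF HF] := frameP H; set F := frame H in FF HF.
pose P (x : 'rV[R]_n) : 'rV[R]_n := x - x *m F^T *m F.
have mP : measurable_fun setT P.
  apply: measurable_funD_rV => //.
  apply: (measurableT_comp (@measurable_opprV R n)).
  exact: (measurableT_comp (@measurable_mulmxr R n _ F)
    (@measurable_mulmxr R _ _ F^T)).
rewrite (_ : [set` H] = setT `&` P @^-1` [set 0]).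
  by apply: mP => //; exact: measurable_origin.
rewrite HF; apply/seteqP; split => x /=.
  move=> [u _ <-]; split => //; rewrite /P.
  by rewrite -(mulmxA u) FF mulmx1 subrr.
by move=> [_ /eqP]; rewrite /P subr_eq0 => /eqP ->; exists (x *m F^T).
Qed.

Lemma frame_preimage (H : {vspace 'rV[R]_n}) :
  (fun u => u *m frame H) @^-1` [set` H] = setT.
Proof.
have [_ HF] := frameP H; apply/seteqP; split => u //= _.
have : range (fun u : 'rV[R]_(\dim H) => u *m frame H) (u *m frame H) by exists u.
by rewrite -HF.
Qed.

Lemma ge0_integral_subspace (H : {vspace 'rV[R]_n}) D (h : 'rV[R]_n -> \bar R) :
  measurable D -> measurable_fun setT h -> (forall x, (0 <= h x)%E) ->
  (\int[lebesgue_subspace H]_(x in D `&` [set` H]) h x =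
   \int[lebesgue_rV (\dim H)]_u (h \_ D) (u *m frame H))%E.
Proof.
move=> mD mh h0; have mDH := measurableI _ _ mD (measurable_subspace H).
rewrite (ge0_integral_pushforward (measurable_mulmxr (frame H)) _ mDH)//; last first.
  exact: measurable_funTS.
rewrite preimage_setI frame_preimage setIT [LHS]integral_mkcond.
by apply: eq_integral => u _; rewrite !patchE.
Qed.

(** The unit sphere of H is the isometric image of a standard unit sphere. *)
Lemma subsphere_measureE (H : {vspace 'rV[R]_n}) A : measurable A ->
  subsphere_measure H A = push_measure (@sphere_measure R (\dim H))
    (measurable_mulmxr (frame H)) A.
Proof.
move=> mA; have [FF _] := frameP H.
transitivity (surface_measure (\dim H) (lebesgue_rV (\dim H))
    ((fun u => u *m frame H) @^-1` A)) => //.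
rewrite /subsphere_measure !surface_measureE; congr (_ * _)%E.
rewrite /lebesgue_subspace /push_measure /pushforward; congr (lebesgue_rV _ _).
by apply/seteqP; split => u /=; rewrite enorm_mulmx// scalemxAl.
Qed.

Lemma ge0_integral_subsphere (H : {vspace 'rV[R]_n}) (g : 'rV[R]_n -> \bar R) :
  measurable_fun unit_sphere g -> (forall x, unit_sphere x -> (0 <= g x)%E) ->
  (\int[subsphere_measure H]_(x in unit_sphere `&` [set` H]) g x =
   \int[@sphere_measure R (\dim H)]_(u in unit_sphere) g (u *m frame H))%E.
Proof.
move=> mg g0; have [FF _] := frameP H.
have mS := @measurable_unit_sphere R n.
have mSH := measurableI _ _ mS (measurable_subspace H).
rewrite (eq_measure_integral (push_measure (@sphere_measure R (\dim H))
    (measurable_mulmxr (frame H)))); last first.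
  by move=> A mA _; exact: subsphere_measureE.
rewrite (ge0_integral_pushforward (measurable_mulmxr (frame H)) _ mSH)//.
- rewrite preimage_setI frame_preimage setIT.
  rewrite (_ : _ @^-1` unit_sphere = unit_sphere)//.
  by apply/seteqP; split => u; rewrite /unit_sphere/= enorm_mulmx.
- by apply: measurable_funS mg => // x [].
- by move=> x /set_mem[Sx _]; exact: g0.
Qed.

End frames.

(** * Unit spheres and orthonormal frames *)

Section unit_sphere.
Context {R : realType}.

Lemma unit_sphere_neq0 n (x : 'rV[R]_n) : unit_sphere x -> x != 0.
Proof. by rewrite -enorm_gt0 => ->. Qed.

Lemma unit_sphere_compact n : compact (@unit_sphere R n).
Proof.
apply: bounded_closed_compact.
  exists 1; split; first exact: num_real.
  move=> M M1 x /= Sx; rewrite (le_trans (le_norm_enorm x))//.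
  by rewrite [enorm x]Sx ltW.
rewrite (_ : unit_sphere = enorm @^-1` [set 1]) //.
apply: (continuous_closedP _).1; first exact: continuous_enorm.
exact: closed_eq.
Qed.

Lemma sphere_measureT_lty n : (@sphere_measure R n setT < +oo)%E.
Proof.
rewrite /sphere_measure surface_measureE lte_mul_pinfty//.
apply: le_lt_trans (lebesgue_rV_unit_ball_lty n).
rewrite [X in (lebesgue_rV n X <= _)%E](_ : _ = punctured_unit_ball); last first.
  apply/seteqP; split => x /=; first by case.
  by move=> xB; split => //; exact: xB.
apply: le_measure; rewrite ?inE; [exact: measurable_punctured_unit_ball|
  exact: measurable_unit_ball|by move=> x /andP[]].
Qed.

Lemma sphere_measure_unit_sphere n : (0 < n)%N ->
  @sphere_measure R n unit_sphere = (n%:R%:E * lebesgue_rV n (@unit_ball R n))%E.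
Proof.
move=> n0; rewrite /sphere_measure surface_measureE -lebesgue_rV_punctured_ball//.
congr (_ * lebesgue_rV _ _)%E; apply/seteqP; split => x /=; first by case.
move=> xB; split => //; apply: enorm_radial.
by rewrite -enorm_gt0; move: xB => /andP[].
Qed.

Lemma ge0_integral_sphereT n (g : 'rV[R]_n -> \bar R) :
  measurable_fun setT g -> (forall x, (0 <= g x)%E) ->
  (\int[@sphere_measure R n]_x g x = \int[@sphere_measure R n]_(x in unit_sphere) g x)%E.
Proof.
move=> mg g0; rewrite [RHS]integral_mkcond ge0_integral_sphere// ge0_integral_sphere//.
- congr (_ * _)%E; apply: eq_integral => y; rewrite inE => yB.
  rewrite patchE mem_set//; apply: enorm_radial.
  by rewrite -enorm_gt0; move: yB => /andP[].
- apply/(measurable_restrictT _ _).1; first exact: measurable_unit_sphere.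
  exact: measurable_funTS.
- by move=> x; rewrite patchE; case: ifP.
Qed.

Lemma integrable_compact n (mu : {measure set 'rV[R]_n -> \bar R})
    (U D : set 'rV[R]_n) (g : 'rV[R]_n -> R) :
  open U -> D `<=` U -> compact D -> measurable D -> (mu D < +oo)%E ->
  {in U, continuous g} -> mu.-integrable D (EFin \o g).
Proof.
move=> oU DU cD mD fD cg; apply: measurable_bounded_integrable => //.
  by apply: (@measurable_funS _ _ _ _ U) => //; [exact: open_measurable_rV|
    exact: open_continuous_measurable_rV].
have : compact (g @` D).
  apply: continuous_compact => //; apply: continuous_in_subspaceT => x xD.
  by apply: cg; apply/mem_set/DU/set_mem.
move=> /compact_bounded[M [Mr gM]]; exists M; split => // N MN x Dx /=.
by apply: gM => //; exists x.
Qed.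

End unit_sphere.

Section matrix_continuity.
Context {R : realType}.

Lemma cvg_rV (T : Type) (F : set_system T) {FF : Filter F} n
    (g : T -> 'rV[R]_n) (l : 'rV[R]_n) :
  (forall j, g x 0 j @[x --> F] --> l 0 j) -> g x @[x --> F] --> l.
Proof.
move=> gl; apply/cvgrPdist_lt => e e0.
have : \forall x \near F, forall j, `|l 0 j - g x 0 j| < e.
  apply: filter_forall => j; have /cvgrPdist_lt := gl j.
  exact.
by apply: filterS => x gx; apply/mx_norm_lt => // j; rewrite !mxE; exact: gx.
Qed.

Lemma continuous_mul_vec_mx m n :
  continuous (fun z : 'rV[R]_(m * n) * 'rV[R]_m => z.2 *m vec_mx z.1).
Proof.
move=> z; apply: (@cvg_rV _ (nbhs z)) => j; rewrite mxE.
under eq_fun do rewrite mxE.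
apply: (@cvg_bigsum _ _ _ (nbhs z)) => i; apply: cvgM.
  apply: (@continuous_comp _ _ _ (@snd 'rV[R]_(m * n) 'rV[R]_m) (fun u => u 0 i) z).
    exact: cvg_snd.
  exact: coord_continuous.
rewrite mxE; under eq_fun do rewrite mxE.
apply: (@continuous_comp _ _ _ (@fst 'rV[R]_(m * n) 'rV[R]_m)
  (fun u => u 0 (mxvec_index i j)) z).
  exact: cvg_fst.
exact: coord_continuous.
Qed.

(** A frame is encoded by the row vector of its entries, so that the Heine-Borel
    theorem of R^(mn) applies. *)
Definition stiefel m n : set 'rV[R]_(m * n) :=
  [set v | vec_mx v *m (vec_mx v)^T = 1%:M :> 'M[R]_m].

Lemma stiefel_compact m n : compact (@stiefel m n).
Proof.
apply: bounded_closed_compact.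
  exists 1; split; first exact: num_real.
  move=> M M1 v /= Vv; apply/ltW/mx_norm_lt; first by rewrite (lt_trans _ M1).
  move=> k; apply: le_lt_trans M1; case/mxvec_indexP: k => i j.
  have -> : v 0 (mxvec_index i j) = (row i (vec_mx v)) 0 j by rewrite !mxE.
  apply: le_trans (le_coord_enorm _ _) _.
  rewrite -(@expr_le1 _ 2) ?enorm_ge0//.
  rewrite -enorm_sqr; move/matrixP : Vv => /(_ i i); rewrite !mxE eqxx => Vi.
  rewrite le_eqVlt -[X in _ == X]Vi; apply/orP; left; apply/eqP/eq_bigr => l _.
  by rewrite !mxE.
rewrite (_ : @stiefel m n = \bigcap_(i in [set: 'I_m]) \bigcap_(j in [set: 'I_m])
   (fun v : 'rV[R]_(m * n) => \sum_l v 0 (mxvec_index i l) * v 0 (mxvec_index j l))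
     @^-1` [set (i == j)%:R]).
  apply: closed_bigI => i _; apply: closed_bigI => j _.
  apply: (continuous_closedP _).1; last exact: closed_eq.
  move=> v; apply: (@cvg_bigsum _ _ _ (nbhs v)) => l.
  by apply: cvgM; exact: coord_continuous.
apply/seteqP; split => v.
  move=> /matrixP Vv i _ j _ /=; have := Vv i j; rewrite !mxE => <-.
  by apply: eq_bigr => l _; rewrite !mxE.
move=> Vv; apply/matrixP => i j; have /= := Vv i Logic.I j Logic.I; rewrite !mxE => <-.
by apply: eq_bigr => l _; rewrite !mxE.
Qed.

End matrix_continuity.

(** * Sections of a star body *)

Section sections.
Context {R : realType} {n : nat}.
Variables (K : set 'rV[R]_n) (f : 'rV[R]_n -> R).
Hypothesis K_star : star_body K.
Hypothesis f_continuous : continuous f.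
Hypothesis f_ge0 : forall x, 0 <= f x.

Let nonzero := [set x : 'rV[R]_n | x != 0].

Lemma open_nonzero k : open [set x : 'rV[R]_k | x != 0].
Proof.
rewrite (_ : mkset _ = enorm @^-1` `]0, +oo[%classic).
  by apply: open_comp; [move=> x _; exact: continuous_enorm|exact: interval_open].
by apply/seteqP; split => x /=; rewrite in_itv/= andbT enorm_gt0.
Qed.

Lemma mul_frame_neq0 m (E : 'M[R]_(m, n)) (u : 'rV[R]_m) :
  E *m E^T = 1%:M -> u != 0 -> u *m E != 0.
Proof. by move=> EE; rewrite -!enorm_gt0 enorm_mulmx. Qed.

Lemma measurable_ray_integral d : measurable_fun unit_sphere (ray_integral K f d).
Proof.
apply: (@measurable_funS _ _ _ _ nonzero).
- by apply: open_measurable_rV; exact: open_nonzero.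
- by move=> x; exact: unit_sphere_neq0.
- apply: open_continuous_measurable_rV; first exact: open_nonzero.
  by move=> x /set_mem; exact: ray_integral_continuous.
Qed.

Lemma ge0_integral_density_frame m (E : 'M[R]_(m, n)) : (0 < m)%N ->
  E *m E^T = 1%:M ->
  (\int[lebesgue_rV m]_u density_on K f (u *m E) =
   \int[@sphere_measure R m]_(u in unit_sphere) (ray_integral K f m (u *m E))%:E)%E.
Proof.
move=> m0 EE.
have mE : measurable_fun setT (fun u => density_on K f (u *m E)).
  exact: (measurableT_comp (measurable_density_on K_star f_continuous)
    (@measurable_mulmxr R n m E)).
have E0 u : (0 <= density_on K f (u *m E))%E by exact: density_on_ge0.
rewrite (polar_coordinates m0 mE E0) ge0_integral_sphereT; last 2 first.
- exact: (measurable_radial_integral m mE E0).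
- by move=> u; apply: integral_ge0 => t _; exact: (mule_radial_weight_ge0 _ _ (E0 _)).
apply: eq_integral => u /set_mem/unit_sphere_neq0 u0.
rewrite -ray_integralE//; last exact: mul_frame_neq0.
by apply: eq_integral => t _; rewrite scalemxAl.
Qed.

Lemma section_measureE m (H : grassmannian R n m) (E : 'M[R]_(m, n)) :
  E *m E^T = 1%:M -> [set` val H] = range (fun u : 'rV[R]_m => u *m E) ->
  section_measure f K H = (\int[lebesgue_rV m]_u density_on K f (u *m E))%E.
Proof.
move=> EE HE; have [FF HF] := frameP (val H).
have mf : measurable_fun setT (EFin \o f).
  by apply/measurable_EFinP; exact: continuous_measurable_rV.
rewrite /section_measure /density_measure ge0_integral_subspace//;
  last exact: (measurable_star_body K_star).
rewrite -(ge0_integral_frame FF EE _ (measurable_density_on K_star f_continuous)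
  (density_on_ge0 K f_ge0)); last by rewrite -HF.
apply: eq_integral => u _; rewrite patchE /density_on indicE.
by case: ifP => _; rewrite ?mulr1 ?mulr0.
Qed.

Lemma orthonormal_frame_dim m (H : grassmannian R n m) :
  exists E : 'M[R]_(m, n), E *m E^T = 1%:M /\
    [set` val H] = range (fun u : 'rV[R]_m => u *m E).
Proof.
have [] := frameP (val H); move: (frame (val H)).
by have /eqP -> := valP H => E EE HE; exists E.
Qed.

Lemma span_frame m (E : 'M[R]_(m, n)) : E *m E^T = 1%:M ->
  exists H : grassmannian R n m, [set` val H] = range (fun u : 'rV[R]_m => u *m E).
Proof.
move=> EE; pose L : 'Hom('rV[R]_m, 'rV[R]_n) := linfun (mulmxr E).
have LE u : L u = u *m E by rewrite lfunE.
have dL : \dim (limg L) == m.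
  rewrite limg_dim_eq ?dimvf /dim/= ?mul1n//.
  rewrite capfv; apply/eqP/lker0P => u v; rewrite !LE => /(congr1 (mulmxr E^T)) /=.
  by rewrite -!mulmxA EE !mulmx1.
exists (Sub (limg L) dL); rewrite SubK; apply/seteqP; split => x /=.
  by move=> /memv_imgP[u _ ->]; exists u; rewrite ?LE.
by move=> [u _ <-]; rewrite -LE memv_img// memvf.
Qed.

Lemma subsphere_measureT_lty (H : {vspace 'rV[R]_n}) :
  (subsphere_measure H setT < +oo)%E.
Proof.
rewrite subsphere_measureE//; exact: sphere_measureT_lty.
Qed.

Lemma subsphere_integrable (H : {vspace 'rV[R]_n}) (g : 'rV[R]_n -> R) :
  {in nonzero, continuous g} ->
  (subsphere_measure H).-integrable (unit_sphere `&` [set` H]) (EFin \o g).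
Proof.
move=> cg; apply: (@integrableS _ _ _ _ unit_sphere) => //.
- exact: measurable_unit_sphere.
- exact: measurableI (@measurable_unit_sphere _ _) (measurable_subspace H).
apply: (@integrable_compact _ _ _ nonzero) => //.
- exact: open_nonzero.
- by move=> x; exact: unit_sphere_neq0.
- exact: unit_sphere_compact.
- exact: measurable_unit_sphere.
- apply: le_lt_trans (subsphere_measureT_lty H); apply: le_measure; rewrite ?inE//.
  exact: measurable_unit_sphere.
Qed.

(** Polar coordinates in H, the rays of whose section are the rays of K. *)
Lemma section_radon m (H : grassmannian R n m) : (0 < m)%N ->
  section_measure f K H = (spherical_radon (ray_integral K f m) H)%:E.
Proof.
move=> m0; have [FF HF] := frameP (val H); have /eqP dm := valP H.
rewrite /spherical_radon /Rintegral fineK; last first.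
  apply: integrable_fin_num.
    exact: measurableI (@measurable_unit_sphere _ _) (measurable_subspace _).
  apply: subsphere_integrable => x /set_mem; exact: ray_integral_continuous.
rewrite ge0_integral_subsphere; last 2 first.
- by apply/measurable_EFinP; exact: measurable_ray_integral.
- by move=> x /unit_sphere_neq0 x0; rewrite lee_fin ray_integral_ge0.
have [E [EE HE]] := orthonormal_frame_dim H.
rewrite (section_measureE EE HE) -(ge0_integral_frame FF EE _
  (measurable_density_on K_star f_continuous) (density_on_ge0 K f_ge0));
  last by rewrite -HF.
have d0 : (0 < \dim (val H))%N by rewrite dm.
rewrite (ge0_integral_density_frame d0 FF); apply: eq_integral => u _.
by have -> : ray_integral K f (\dim (val H)) = ray_integral K f m by rewrite dm.
Qed.

(** The measure of the section by the span of a frame (see frame_sectionE). The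
    integration is over a fixed sphere, whatever the frame. *)
Definition frame_section m (v : 'rV[R]_(m * n)) : R :=
  \int[@sphere_measure R m]_(u in unit_sphere) ray_integral K f m (u *m vec_mx v).

Let integrand_continuous m (v : 'rV[R]_(m * n)) (u : 'rV[R]_m) :
  u *m vec_mx v != 0 ->
  {for (v, u), continuous (fun z : 'rV[R]_(m * n) * 'rV[R]_m =>
    ray_integral K f m (z.2 *m vec_mx z.1))}.
Proof.
move=> vu0.
apply: (@continuous_comp _ _ _ (fun z : 'rV[R]_(m * n) * 'rV[R]_m => z.2 *m vec_mx z.1)
  (ray_integral K f m) (v, u)).
  exact: continuous_mul_vec_mx.
exact: ray_integral_continuous.
Qed.

Let integrand_integrable m (v : 'rV[R]_(m * n)) :
  (forall u, unit_sphere u -> u *m vec_mx v != 0) ->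
  (@sphere_measure R m).-integrable unit_sphere
    (EFin \o (fun u => ray_integral K f m (u *m vec_mx v))).
Proof.
move=> v0; have cv : continuous (fun u : 'rV[R]_m => u *m vec_mx v).
  move=> u; apply: (@continuous_comp _ _ _ (fun u : 'rV[R]_m => (v, u))
    (fun z : 'rV[R]_(m * n) * 'rV[R]_m => z.2 *m vec_mx z.1) u).
    exact: (@cvg_pair _ _ _ (nbhs u) (nbhs v) (nbhs u) _ _ _ (fun=> v) id
      (cvg_cst v) cvg_id).
  exact: continuous_mul_vec_mx.
apply: (@integrable_compact _ _ _ [set u | u *m vec_mx v != 0]) => //.
- rewrite (_ : mkset _ = (fun u => u *m vec_mx v) @^-1` nonzero)//.
  by apply: open_comp; [move=> u _; exact: cv|exact: open_nonzero].
- exact: unit_sphere_compact.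
- exact: measurable_unit_sphere.
- apply: le_lt_trans (sphere_measureT_lty m); apply: le_measure; rewrite ?inE//.
  exact: measurable_unit_sphere.
- move=> u /set_mem vu0.
  apply: (@continuous_comp _ _ _ (fun u : 'rV[R]_m => u *m vec_mx v) (ray_integral K f m) u).
    exact: cv.
  exact: ray_integral_continuous.
Qed.

Lemma frame_section_continuous m (v : 'rV[R]_(m * n)) :
  stiefel v -> {for v, continuous (@frame_section m)}.
Proof.
move=> Vv; have v0 u : unit_sphere u -> u *m vec_mx v != 0.
  by move=> /unit_sphere_neq0; exact: mul_frame_neq0.
apply: continuous_Rintegral.
- exact: measurable_unit_sphere.
- apply: le_lt_trans (sphere_measureT_lty m); apply: le_measure; rewrite ?inE//.
  exact: measurable_unit_sphere.
(* nearby matrices still have no unit vector in their kernel *)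
- have := @near_uniformly R _ _ unit_sphere
    (fun (w : 'rV[R]_(m * n)) (u : 'rV[R]_m) => enorm (u *m vec_mx w)) v
    (@unit_sphere_compact R m) _ 2^-1 _.
  move=> /(_ _ _)/filterS; apply.
  + move=> w hw; apply: integrand_integrable => u Su; rewrite -enorm_gt0.
    have := hw u Su; rewrite (enorm_mulmx _ Vv) [enorm u]Su ler_norml => /andP[+ _].
    by rewrite lerBrDl; apply: lt_le_trans; rewrite subr_gt0 invf_lt1// ltr1n.
  + move=> u Su.
    apply: (@continuous_comp _ _ _ (fun z : 'rV[R]_(m * n) * 'rV[R]_m => z.2 *m vec_mx z.1)
      enorm (v, u)); [exact: continuous_mul_vec_mx|exact: continuous_enorm].
  + by rewrite invr_gt0.
- apply: near_uniformly; first exact: unit_sphere_compact.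
  by move=> u Su; apply: integrand_continuous; exact: v0.
Qed.

Lemma frame_sectionE m (H : grassmannian R n m) (v : 'rV[R]_(m * n)) : (0 < m)%N ->
  stiefel v -> [set` val H] = range (fun u : 'rV[R]_m => u *m vec_mx v) ->
  section_measure f K H = (frame_section v)%:E.
Proof.
move=> m0 Vv Hv; rewrite (section_measureE Vv Hv) (ge0_integral_density_frame m0 Vv).
rewrite /frame_section /Rintegral fineK//; apply: integrable_fin_num.
  exact: measurable_unit_sphere.
apply: integrand_integrable => u /unit_sphere_neq0; exact: mul_frame_neq0.
Qed.

(** Every subspace of dimension m is the span of a frame in a compact set, and the
    section measure is continuous in the frame. *)
Lemma section_measure_max m : (0 < m <= n)%N ->
  exists Hmax : grassmannian R n m, forall H : grassmannian R n m,
    (section_measure f K H <= section_measure f K Hmax)%E.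
Proof.
move=> /andP[m0 mn].
have V0 : @stiefel R m n !=set0.
  exists (mxvec (pid_mx m)); rewrite /stiefel/= mxvecK tr_pid_mx mul_pid_mx.
  by rewrite minnn (minn_idPr mn) pid_mx_1.
have [|v /set_mem Vv vmax] := @EVT_max_rV R _ (@frame_section m) _ V0 (@stiefel_compact R m n).
  apply: continuous_in_subspaceT => v /set_mem; exact: frame_section_continuous.
have [Hmax HE] := span_frame Vv; exists Hmax => H.
have [E [EE HEE]] := orthonormal_frame_dim H.
have Ve : stiefel (mxvec E) by rewrite /stiefel/= mxvecK.
have He : [set` val H] = range (fun u : 'rV[R]_m => u *m vec_mx (mxvec E)).
  by rewrite mxvecK.
rewrite (frame_sectionE m0 Vv HE) (frame_sectionE m0 Ve He) lee_fin.
by apply: vmax; exact: mem_set.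
Qed.

End sections.

(** * The volume inequality *)

Section moments.
Context {R : realType}.
Local Open Scope ereal_scope.

(** Hoelder's inequality against the constant function 1. *)
Lemma integral_exprn_hoelder d (T : measurableType d) (mu : {measure set T -> \bar R})
    (D : set T) (r : T -> R) (n k : nat) :
  measurable D -> measurable_fun D r -> (forall x, D x -> (0 <= r x)%R) ->
  (0 < k < n)%N ->
  \int[mu]_(x in D) (r x ^+ k)%:E <=
  mu D `^ ((n - k)%:R / n%:R) * (\int[mu]_(x in D) (r x ^+ n)%:E) `^ (k%:R / n%:R).
Proof.
move=> mD mr r0 /andP[k0 kn].
have k0' : (0 < k%:R :> R)%R by rewrite ltr0n.
have n0' : (0 < n%:R :> R)%R by rewrite ltr0n (leq_trans _ kn).
have m0' : (0 < (n - k)%:R :> R)%R by rewrite ltr0n subn_gt0.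
pose g x : R := (r \_ D) x.
have g0 x : (0 <= g x)%R.
  by rewrite /g patchE; case: ifPn => // /set_mem; exact: r0.
have mg : measurable_fun setT g by apply/(measurable_restrictT _ mD).1.
have gE x j : D x -> (g x ^+ j = r x ^+ j)%R.
  by move=> Dx; rewrite /g patchE mem_set.
have mgj j : measurable_fun setT (fun x => (g x ^+ j)%:E).
  by apply/measurable_EFinP; exact: measurable_funX.
have gj0 j x : 0 <= (g x ^+ j)%:E by rewrite lee_fin exprn_ge0.
have gI j : \int[mrestr mu mD]_x (g x ^+ j)%:E = \int[mu]_(x in D) (r x ^+ j)%:E.
  rewrite (ge0_integral_mrestr mu mD (mgj j) (gj0 j)).
  by apply: eq_integral => x /set_mem Dx; rewrite gE.
have pq : ((n%:R / k%:R)^-1 + (n%:R / (n - k)%:R)^-1 = 1 :> R)%R.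
  rewrite !invf_div -mulrDl -natrD subnKC ?(ltnW kn)// divff// gt_eqF//.
have m1 : measurable_fun setT (cst 1%R : T -> R) by [].
have := hoelder (mrestr mu mD) (measurable_funX k mg) m1
  (divr_gt0 n0' k0') (divr_gt0 n0' m0') pq.
rewrite Lnorm1.
rewrite (eq_integral (fun x => (g x ^+ k)%:E)); last first.
  by move=> x _ /=; rewrite mulr1 ger0_norm// exprn_ge0.
rewrite gI => /le_trans; apply.
have N1 : 'N[mrestr mu mD]_(n%:R / (n - k)%:R)%:E[cst 1] =
    mu D `^ ((n - k)%:R / n%:R).
  rewrite Lnorm_cst1 invf_div; congr (_ `^ _).
  by rewrite -[LHS]/(mu (setT `&` D)) setTI.
have Nk : 'N[mrestr mu mD]_(n%:R / k%:R)%:E[EFin \o (fun x => g x ^+ k)%R] =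
    (\int[mu]_(x in D) (r x ^+ n)%:E) `^ (k%:R / n%:R).
  rewrite unlock /Lnorm invf_div; congr (_ `^ _); rewrite -gI.
  apply: eq_integral => x _ /=.
  rewrite ger0_norm ?exprn_ge0// -powR_mulrn// -powRrM mulrC divfK ?gt_eqF//.
  by rewrite powR_mulrn.
by rewrite -N1 -Nk muleC.
Qed.

End moments.

Section sphere.
Context {R : realType}.

Lemma ball_volumeE m : (ball_volume R m)%:E = lebesgue_rV m (@unit_ball R m).
Proof. by rewrite /ball_volume fineK// lebesgue_rV_unit_ball_fin_num. Qed.

Lemma ball_volume_gt0 m : 0 < ball_volume R m.
Proof. by rewrite -lte_fin ball_volumeE lebesgue_rV_unit_ball_gt0. Qed.

Section body.
Variables (n : nat) (K : set 'rV[R]_n).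
Hypothesis n0 : (0 < n)%N.
Hypothesis K_star : star_body K.

Lemma density_measure_polar (f : 'rV[R]_n -> R) : continuous f -> (forall x, 0 <= f x) ->
  density_measure (lebesgue_rV n) f K =
  (\int[@sphere_measure R n]_(x in unit_sphere) (ray_integral K f n x)%:E)%E.
Proof.
move=> fc f0; have E1 : (1%:M : 'M[R]_n) *m 1%:M^T = 1%:M by rewrite trmx1 mulmx1.
have := ge0_integral_density_frame K_star fc f0 n0 E1.
under eq_integral do rewrite mulmx1.
under [in X in _ = X -> _]eq_integral do rewrite mulmx1.
move=> <-; rewrite /density_measure [LHS]integral_mkcond.
apply: eq_integral => x _.
by rewrite patchE /density_on indicE; case: ifP => _; rewrite ?mulr1 ?mulr0.
Qed.

Lemma volume_polar : lebesgue_rV n K =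
  (\int[@sphere_measure R n]_(x in unit_sphere)
    (n%:R^-1 * radial_function K x ^+ n)%:E)%E.
Proof.
have VE : lebesgue_rV n K = density_measure (lebesgue_rV n) (cst 1) K.
  exact: (esym (etrans (integral_cst (lebesgue_rV n) (measurable_star_body K_star) 1%E)
    (mul1e _))).
have c1 : continuous (cst 1 : 'rV[R]_n -> R) by exact: cst_continuous.
rewrite VE (density_measure_polar c1 (fun=> ler01)).
apply: eq_integral => x _; rewrite /ray_integral mulrC; congr (_ * _)%:E.
rewrite /segment_integral /Rintegral.
under eq_integral do rewrite mul1r.
by rewrite integral_exprn// expr1n prednK// div1r.
Qed.

End body.

Lemma sphere_integrable n (g : 'rV[R]_n -> R) :
  {in [set x | x != 0], continuous g} ->
  (@sphere_measure R n).-integrable unit_sphere (EFin \o g).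
Proof.
move=> cg; apply: (@integrable_compact _ _ _ [set x | x != 0]) => //.
- exact: open_nonzero.
- by move=> x; exact: unit_sphere_neq0.
- exact: unit_sphere_compact.
- exact: measurable_unit_sphere.
- apply: le_lt_trans (sphere_measureT_lty n); apply: le_measure; rewrite ?inE//.
  exact: measurable_unit_sphere.
Qed.

Lemma spherical_radon_cst n m (H : grassmannian R n m) (c : R) : (0 < m)%N ->
  spherical_radon (fun=> c) H = c * (m%:R * ball_volume R m).
Proof.
move=> m0; have /eqP dm := valP H; have d0 : (0 < \dim (val H))%N by rewrite dm.
have mSH := measurableI _ _ (@measurable_unit_sphere R n) (measurable_subspace (val H)).
have SH : subsphere_measure (val H) (unit_sphere `&` [set` val H]) =
    (m%:R * ball_volume R m)%:E.
  have [FF _] := frameP (val H).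
  rewrite subsphere_measureE//.
  transitivity (@sphere_measure R (\dim (val H)) unit_sphere).
    congr (sphere_measure _); rewrite preimage_setI frame_preimage setIT.
    by apply/seteqP; split => u; rewrite /unit_sphere/= enorm_mulmx.
  by rewrite sphere_measure_unit_sphere// dm EFinM ball_volumeE.
have fSH : subsphere_measure (val H) (unit_sphere `&` [set` val H]) \is a fin_num.
  by rewrite SH.
transitivity (\int[subsphere_measure (val H)]_(x in unit_sphere `&` [set` val H]) c) => //.
rewrite Rintegral_cst//.
exact: (congr1 (fun v => c * fine v) SH).
Qed.

(** The integral is the value, at the Radon transform of g, of the positive
    functional that makes K a generalized intersection body. *)
Lemma generalized_intersection_body_ge0 n k (K : set 'rV[R]_n) (g : 'rV[R]_n -> R) :
  generalized_intersection_body k K -> sphere_continuous g ->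
  (forall H : grassmannian R n (n - k), 0 <= spherical_radon g H) ->
  0 <= \int[@sphere_measure R n]_(x in unit_sphere) (radial_function K x ^+ k * g x).
Proof.
move=> [_ _ [nu [[_ _ nu0] nuE]]] cg Rg.
have := nu0 (@spherical_radon _ _ (n - k) g) _ Rg; rewrite -nuE//.
have -> : (fun x => minkowski_functional K x ^- k * g x) =
    (fun x => radial_function K x ^+ k * g x).
  by apply/funext => x; rewrite /radial_function exprVn.
by apply; exists g.
Qed.

End sphere.

Section volume_inequality.
Context {R : realType} {n k : nat}.
Variables (f : 'rV[R]_n -> R) (K : set 'rV[R]_n).
Hypothesis f_continuous : continuous f.
Hypothesis f_ge0 : forall x, 0 <= f x.
Hypothesis k_range : (0 < k < n)%N.
Hypothesis K_body : generalized_intersection_body k K.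

Let K_star : star_body K. Proof. by have [] := K_body. Qed.
Let kn : (k < n)%N. Proof. by have /andP[] := k_range. Qed.
Let n0 : (0 < n)%N. Proof. exact: leq_ltn_trans kn. Qed.
Let m0 : (0 < n - k)%N. Proof. by rewrite subn_gt0. Qed.

Local Notation rho := (radial_function K).
Local Notation G := (ray_integral K f (n - k)).
Local Notation sigma := (@sphere_measure R n).

Let c_rhok : {in [set x | x != 0], continuous (fun x => rho x ^+ k)}.
Proof.
move=> x /set_mem x0; have rc := radial_function_continuous K_star x0.
by apply: (@continuous_comp _ _ _ rho (fun s : R => s ^+ k) x);
  [exact: rc|exact: exprn_continuous].
Qed.

Let c_rhokG : {in [set x | x != 0], continuous (fun x => rho x ^+ k * G x)}.
Proof.
move=> x xE; have x0 := set_mem xE.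
exact: cvgM (c_rhok xE) (ray_integral_continuous K_star f_continuous (d := n - k) x0).
Qed.

(** With c = M / (m |B^m|), the Radon transform of c - G is at H the difference
    between M and the section measure, hence non-negative, and positivity
    applies to c - G. *)
Lemma weighted_ray_integral_le (M : R) :
  (forall H : grassmannian R n (n - k), (section_measure f K H <= M%:E)%E) ->
  \int[sigma]_(x in unit_sphere) (rho x ^+ k * G x) <=
  M / ((n - k)%:R * ball_volume R (n - k)) *
    \int[sigma]_(x in unit_sphere) (rho x ^+ k).
Proof.
move=> HM; set c := M / _.
have cB : c * ((n - k)%:R * ball_volume R (n - k)) = M.
  by rewrite divfK// mulf_neq0 ?gt_eqF ?ball_volume_gt0// ltr0n.
have cG : {in [set x : 'rV[R]_n | x != 0], continuous G}.
  by move=> x /set_mem; exact: ray_integral_continuous.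
have S0 : {subset unit_sphere <= [set x : 'rV[R]_n | x != 0]}.
  by move=> x /set_mem/unit_sphere_neq0 x0; exact: mem_set.
have := @generalized_intersection_body_ge0 R n k K (fun x => c - G x) K_body _ _.
have -> : (fun x => rho x ^+ k * (c - G x)) =
    (fun x => c * rho x ^+ k - rho x ^+ k * G x).
  by apply/funext => x; ring.
have i1 := sphere_integrable c_rhok.
have i2 := sphere_integrable c_rhokG.
have mS := @measurable_unit_sphere R n.
rewrite RintegralB//; last first.
  rewrite (_ : _ \o _ = (fun x => c%:E * (EFin \o (fun x => (rho x ^+ k)%R)) x)%E)//.
  exact: integrableZl.
rewrite (RintegralZl c mS i1) subr_ge0; apply.
  apply: continuous_in_subspaceT => x xS; have cGx := cG x (S0 x xS).
  exact: (@cvgB _ _ _ (nbhs x) _ (fun=> c) G _ _ (cvg_cst c) cGx).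
move=> H.
have -> : spherical_radon (fun x => c - G x) H =
    spherical_radon (fun=> c) H - spherical_radon G H.
  rewrite /spherical_radon RintegralB//.
  - exact: measurableI (measurable_subspace _).
  - by apply: subsphere_integrable => x _; exact: (@cst_continuous _ _ c x).
  - exact: subsphere_integrable.
rewrite spherical_radon_cst// cB subr_ge0 -lee_fin -section_radon//.
Qed.

(** Along the ray t^(n-1) <= rho(x)^k t^(m-1), as t <= rho(x). *)
Lemma density_measure_le :
  (density_measure (lebesgue_rV n) f K <=
   (\int[sigma]_(x in unit_sphere) (rho x ^+ k * G x))%:E)%E.
Proof.
have mS := @measurable_unit_sphere R n.
rewrite (density_measure_polar n0 K_star f_continuous f_ge0).
rewrite /Rintegral fineK; last exact: integrable_fin_num (sphere_integrable c_rhokG).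
apply: ge0_le_integral => //.
- by move=> x /unit_sphere_neq0 x0; rewrite lee_fin ray_integral_ge0.
- by apply/measurable_EFinP; exact: measurable_ray_integral.
- exact: measurable_int (sphere_integrable c_rhokG).
- move=> x /unit_sphere_neq0 x0; rewrite lee_fin /ray_integral mulrA -exprD.
  rewrite subnKC ?(ltnW kn)// ler_wpM2l//.
    by rewrite exprn_ge0// ltW// radial_function_gt0.
  by apply: segment_integral_le => //; exact: leq_subr.
Qed.

Lemma radial_moment_le :
  ((\int[sigma]_(x in unit_sphere) (rho x ^+ k))%:E <=
   ((n%:R * ball_volume R n) `^ ((n - k)%:R / n%:R))%:E *
   (n%:R%:E * lebesgue_rV n K) `^ (k%:R / n%:R))%E.
Proof.
have mS := @measurable_unit_sphere R n.
rewrite /Rintegral fineK; last exact: integrable_fin_num (sphere_integrable c_rhok).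
have rho0 x : unit_sphere x -> 0 <= rho x.
  by move=> /unit_sphere_neq0 x0; rewrite ltW// radial_function_gt0.
have mrho : measurable_fun unit_sphere rho.
  have crho : {in [set x | x != 0], continuous rho}.
    by move=> x /set_mem; exact: radial_function_continuous.
  by apply/measurable_EFinP; exact: measurable_int (sphere_integrable crho).
apply: (le_trans (integral_exprn_hoelder sigma mS mrho rho0 k_range)).
have sE : sigma unit_sphere = (n%:R * ball_volume R n)%:E.
  by rewrite sphere_measure_unit_sphere// EFinM ball_volumeE.
suff vE : (\int[sigma]_(x in unit_sphere) (rho x ^+ n)%:E =
    n%:R%:E * lebesgue_rV n K)%E.
  rewrite le_eqVlt; apply/orP; left; apply/eqP; congr (_ * _)%E.
    exact: (congr1 (fun v => v `^ _)%E sE).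
  exact: (congr1 (fun v => v `^ _)%E vE).
rewrite (volume_polar n0 K_star) -ge0_integralZl//.
- apply: eq_integral => x _; rewrite -EFinM mulrA divff ?mul1r//.
  by rewrite pnatr_eq0 -lt0n.
- apply/measurable_EFinP; apply: measurable_funM => //; exact: measurable_funX.
- by move=> x Sx; rewrite lee_fin mulr_ge0 ?invr_ge0// exprn_ge0// rho0.
Qed.

End volume_inequality.

(* The maximum over the Grassmannian is asserted to be attained, at Hmax. *)
Theorem corollary5 (R : realType) (n k : nat) (f : 'rV[R]_n -> R)
    (K : set 'rV[R]_n)
    (f_continuous : continuous f)
    (f_even : forall x, f (- x) = f x)
    (f_ge0 : forall x, 0 <= f x)
    (k_range : (1 <= k < n)%N)
    (K_body : generalized_intersection_body k K) :
  exists Hmax : grassmannian R n (n - k),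
    (forall H : grassmannian R n (n - k),
       (section_measure f K H <= section_measure f K Hmax)%E) /\
    (density_measure (lebesgue_rV n) f K <=
       (n%:R / (n - k)%:R * c_const R n k)%:E
       * section_measure f K Hmax
       * (lebesgue_rV n K) `^ (k%:R / n%:R))%E.
Proof.
have [K_star _ _] := K_body.
have [k0 kn] := andP k_range.
have n0 : (0 < n)%N by exact: leq_ltn_trans kn.
have m0 : (0 < n - k)%N by rewrite subn_gt0.
have [|Hmax Hle] := section_measure_max K_star f_continuous f_ge0 (m := n - k).
  by rewrite m0 leq_subr.
exists Hmax; split => //.
have ME := section_radon K_star f_continuous f_ge0 Hmax m0.
rewrite ME in Hle *; set M := spherical_radon _ Hmax in Hle *.
have M0 : 0 <= M.
  rewrite -lee_fin -ME; apply: integral_ge0 => x _; rewrite lee_fin; exact: f_ge0.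
have Bm := ball_volume_gt0 (R := R) (n - k).
have Bn := ball_volume_gt0 (R := R) n.
have nR : 0 < n%:R :> R by rewrite ltr0n.
have mR : 0 < (n - k)%:R :> R by rewrite ltr0n.
apply: (le_trans (density_measure_le f_continuous f_ge0 k_range K_body)).
pose c := M / ((n - k)%:R * ball_volume R (n - k)).
have c0 : 0 <= c by rewrite divr_ge0// ltW// mulr_gt0.
apply: (@le_trans _ _ (c%:E * (\int[@sphere_measure R n]_(x in unit_sphere)
    (radial_function K x ^+ k))%:E)%E).
  rewrite -EFinM lee_fin.
  exact: (weighted_ray_integral_le f_continuous f_ge0 k_range K_body Hle).
apply: (le_trans (lee_wpmul2l _ (radial_moment_le k_range K_body))).
  by rewrite lee_fin.
rewrite poweRM ?lee_fin ?(ltW nR)// poweR_EFin !muleA -!EFinM lee_wpmul2r ?poweR_ge0//.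
rewrite lee_fin (powRM _ (ltW nR) (ltW Bn)) /c /c_const.
(* this produces the factor n of the constant *)
have nE : n%:R `^ ((n - k)%:R / n%:R) * n%:R `^ (k%:R / n%:R) = n%:R :> R.
  rewrite -powRD; last by rewrite (gt_eqF nR) implybT.
  by rewrite -mulrDl -natrD subnK ?(ltnW kn)// divff ?gt_eqF// powRr1// ltW.
move: (_ `^ ((n - k)%:R / n%:R)) (_ `^ (k%:R / n%:R)) nE => A D nE.
move: (ball_volume R n `^ _) => P.
rewrite -nE le_eqVlt; apply/orP; left; apply/eqP; field.
by rewrite !gt_eqF.
Qed.
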